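(* For every confidence threshold $\tau > \mathbf{r}$, the multivariate Hegselmann-Krause process $(\xi_t)_{t \ge 0}$ on the finite connected graph $G = (V, E)$ with i.i.d. initial opinions distributed as $X$ satisfies $$ P(\mathcal{C}) \ \geq \ 1 - \frac{E\,\|X - \mathbf{c}\|}{\tau - \mathbf{r}}, $$ where $\mathcal{C} = \big\{\lim_{t \to \infty} \max_{x, y \in V} \|\xi_t(x) - \xi_t(y)\| = 0\big\}$ is the consensus event.
   Context: Let $G = (V, E)$ be a finite connected (undirected, simple) graph, let $\Delta \subset \mathbb{R}^n$ be a bounded convex set, let $\|\cdot\|$ be an arbitrary norm on $\mathbb{R}^n$, and let $\tau > 0$ be the confidence threshold. The Hegselmann-Krause process is the continuous-time Markov jump process whose state at time $t$ is a configuration $\xi_t : V \to \Delta$, with $\xi_t(x)$ the opinion at vertex $x$ at time $t$. For $x \in V$ let $$ N_t(x) = \{y \in V : (x,y) \in E \text{ and } \|\xi_t(x) - \xi_t(y)\| \leq \tau\} $$ be the set of compatible neighbors of $x$ at time $t$. Each vertex $x$ with $N_t(x) \neq \varnothing$ updates, independently of the other vertices, at rate $|N_t(x)|$; at an update, the opinion at $x$ is replaced by $\frac{1}{|N_t(x)|}\sum_{y \in N_t(x)} \xi_t(y)$ (computed from the configuration just before the update), all other opinions being unchanged. If $N_t(x) = \varnothing$ the update rate at $x$ is zero. The initial opinions $\xi_0(x)$, $x \in V$, are independent and identically distributed; $X$ denotes a $\Delta$-valued random variable with their common law. The radius of the opinion space is $\mathbf{r} = \inf\{r > 0 : \sup_{a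 \in \Delta}\|a - c\| \leq r \text{ for some } c \in \Delta\}$, and the center $\mathbf{c} \in \Delta$ is a point such that $\|a - \mathbf{c}\| \leq \mathbf{r}$ for all $a \in \Delta$ (such a point is assumed to exist and is fixed). *)

(* Defs.v *)
From HB Require Import structures.
From mathcomp Require Import all_boot all_order all_algebra.
From mathcomp Require Import all_classical all_reals all_analysis.

Set Implicit Arguments.
Unset Strict Implicit.
Unset Printing Implicit Defensive.

Import Order.TTheory GRing.Theory Num.Theory.
Import numFieldNormedType.Exports.

Local Open Scope classical_set_scope.
Local Open Scope ring_scope.

Record is_norm (R : realType) (n : nat) (N : 'rV[R]_n -> R) : Prop := {
  norm_triangle : forall u v, N (u + v) <= N u + N v;
  norm_homogeneous : forall (a : R) u, N (a *: u) = `|a| * N u;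
  norm_definite : forall u, N u = 0 -> u = 0 }.

Record simple_connected_graph (V : finType) (E : rel V) : Prop := {
  graph_sym : symmetric E;
  graph_irr : irreflexive E;
  graph_connected : forall x y, connect E x y }.

Definition opinion_radius (R : realType) (n : nat) (N : 'rV[R]_n -> R)
    (Delta : set 'rV[R]_n) : R :=
  inf [set r | 0 < r /\
    exists2 c, Delta c & sup [set N (a - c) | a in Delta] <= r].

(* R^n with its Borel sigma-algebra. *)
Definition borel_rV (R : realType) (n : nat) :=
  g_sigma_algebraType (@open 'rV[R]_n).

Notation config V R n := (V -> 'rV[R]_n) (only parsing).

Definition cylinders (V : finType) (R : realType) (n : nat) :
    set (set (config V R n)) :=
  [set C | exists x : V,
    exists2 B : set (borel_rV R n), measurable B & C = [set eta | B (eta x)]].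

(* Configurations with the product of the Borel sigma-algebras. *)
Definition mconfig (V : finType) (R : realType) (n : nat) :=
  g_sigma_algebraType (@cylinders V R n).

Section dynamics.
Context (R : realType) (n : nat) (N : 'rV[R]_n -> R) (tau : R).
Context (V : finType) (E : rel V).
Implicit Types (eta : config V R n) (f : config V R n -> R).

Definition compatible eta (x : V) : {set V} :=
  [set y | E x y && (N (eta x - eta y) <= tau)]%SET.

(* When [compatible eta x] is empty this value is junk, but it is never used:
   the corresponding term of [generator] has coefficient 0. *)
Definition update eta (x : V) : config V R n := fun z =>
  if z == x then
    (#|compatible eta x|%:R)^-1 *: \sum_(y in compatible eta x) eta y
  else eta z.

(* The infinitesimal generator of the jump process in which the jump
   eta -> update eta x occurs at rate #|compatible eta x|, independently
   for the different vertices x. *)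
Definition generator f : config V R n -> R := fun eta =>
  \sum_(x : V) #|compatible eta x|%:R * (f (update eta x) - f eta).

(* The jump rates are bounded (by the number of oriented edges), hence the
   transition semigroup is exp(t * generator), given on bounded functions by
   the everywhere convergent exponential series. *)
Definition semigroup (t : R) f : config V R n -> R := fun eta =>
  limn (series (fun k => t ^+ k / k`!%:R * iter k generator f eta)).

Definition discord eta : R :=
  \big[Num.max/0]_(p : V * V) N (eta p.1 - eta p.2).

End dynamics.

(* Right-continuous step functions on [0, +oo[ : by compactness, the second
   clause gives finitely many jumps on bounded time intervals. *)
Definition jump_path (R : realType) (S : Type) (path : R -> S) : Prop :=
  forall t, 0 <= t ->
    (\forall s \near t^'+, path s = path t) /\
    (0 < t -> exists eta, \forall s \near t^'-, path s = eta).

Definition natural_filtration (R : realType) (n : nat) (V : finType)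
    (T : Type) (xi : R -> T -> config V R n) (s : R) : set (set T) :=
  <<s \bigcup_(u in `[0, s])
        preimage_set_system [set: T] (xi u : T -> mconfig V R n) measurable >>.

(* The last clause is the Markov property
     P (xi_(s+t) \in B | F_s) = (exp(t * generator) 1_B) (xi_s),
   with conditional probability spelled out on the events A of F_s.
   Only times t >= 0 are constrained. *)
Record Hegselmann_Krause (R : realType) (n : nat) (N : 'rV[R]_n -> R)
    (Delta : set 'rV[R]_n) (tau : R) (V : finType) (E : rel V)
    (d : measure_display) (T : measurableType d) (P : probability T R)
    (xi : R -> T -> config V R n) : Prop := {
  HK_measurable : forall t, 0 <= t ->
    measurable_fun [set: T] (xi t : T -> mconfig V R n);
  HK_opinions : forall t w x, 0 <= t -> Delta (xi t w x);
  HK_paths : forall w, jump_path (fun t => xi t w);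
  HK_markov : forall s t (A : set T) (B : set (mconfig V R n)),
    0 <= s -> 0 <= t -> natural_filtration xi s A -> measurable B ->
    P (A `&` xi (s + t) @^-1` B) =
    (\int[P]_(w in A) (semigroup N tau E t \1_B (xi s w))%:E)%E }.

(* Independence of the whole finite family; subfamilies are covered by taking
   B x to be the whole space. *)
Definition iid_as (R : realType) (n : nat) (V : finType)
    (d : measure_display) (T : measurableType d) (P : probability T R)
    (Y : T -> config V R n)
    (d' : measure_display) (T' : measurableType d') (P' : probability T' R)
    (X : T' -> 'rV[R]_n) : Prop :=
  (forall B : V -> set (borel_rV R n), (forall x, measurable (B x)) ->
    P [set w | forall x, B x (Y w x)] =
    (\prod_(x : V) P [set w | B x (Y w x)])%E) /\
  (forall (x : V) (B : set (borel_rV R n)), measurable B ->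
    P [set w | B (Y w x)] = P' (X @^-1` B)).

Definition consensus (R : realType) (n : nat) (N : 'rV[R]_n -> R)
    (V : finType) (T : Type) (xi : R -> T -> config V R n) : set T :=
  [set w | discord N (xi t w) @[t --> +oo] --> (0 : R)].

(* Main.v *)
(** Lyapunov functions of the generator do all the work.  By convexity of the
    norm and symmetry of the compatibility relation, the mean distance of the
    opinions to the center c is a supermartingale, while the sum of the squared
    coordinates of the total opinion is a bounded submartingale whose drift is
    the dissipation sum_x |N(x)| |update(x) - eta(x)|^2.  Hence the expected
    dissipation is arbitrarily small at suitable times.  When it is small, the
    opinions are almost harmonic, so almost constant on the components of the
    graph of compatible edges: either the discord is small, or every vertex has
    in its component an edge of E to an opinion at distance more than tau, so
    that all opinions are at distance about tau - r at least from c.  Taking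
    expectations bounds the probability of a large discord at these times, and
    the discord is almost surely nonincreasing because updates are averages. *)

Require Import Defs.
From HB Require Import structures.
From mathcomp Require Import all_boot all_order all_algebra.
From mathcomp Require Import all_classical all_reals all_analysis.
From mathcomp Require Import measurable_realfun ring lra.

Set Implicit Arguments.
Unset Strict Implicit.
Unset Printing Implicit Defensive.

Import Order.TTheory GRing.Theory Num.Theory.
Import numFieldNormedType.Exports.

Local Open Scope classical_set_scope.
Local Open Scope ring_scope.

(** * Norms on R^n *)

Section norm.
Context (R : realType) (n : nat) (N : 'rV[R]_n -> R) (hN : is_norm N).

Lemma norm0 : N 0 = 0.
Proof. by have := norm_homogeneous hN 0 0; rewrite scale0r normr0 mul0r. Qed.

Lemma normN u : N (- u) = N u.
Proof. by rewrite -scaleN1r (norm_homogeneous hN) normrN1 mul1r. Qed.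

Lemma normB u v : N (u - v) = N (v - u).
Proof. by rewrite -normN opprB. Qed.

Lemma norm_ge0 u : 0 <= N u.
Proof.
have := norm_triangle hN u (- u); rewrite subrr norm0 normN.
by move=> h; lra.
Qed.

Lemma norm_sum (I : Type) (r : seq I) (p : pred I) (F : I -> 'rV[R]_n) :
  N (\sum_(i <- r | p i) F i) <= \sum_(i <- r | p i) N (F i).
Proof.
elim/big_ind2: _ => [|x1 x2 y1 y2 h1 h2|//]; first by rewrite norm0.
by apply: le_trans (norm_triangle hN _ _) _; exact: lerD.
Qed.

(** A Lipschitz constant of [N] for the sup norm, from the expansion in the canonical basis. *)
Definition norm_const := \sum_(j < n) N (delta_mx 0 j).

Lemma norm_const_ge0 : 0 <= norm_const.
Proof. by apply: sumr_ge0 => j _; exact: norm_ge0. Qed.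

Lemma norm_le_coord (u : 'rV[R]_n) e :
  (forall j, `|u 0 j| <= e) -> N u <= norm_const * e.
Proof.
move=> ue; rewrite {1}[u]row_sum_delta mulr_suml.
apply: le_trans (norm_sum _ _ _) _; apply: ler_sum => j _.
by rewrite (norm_homogeneous hN) mulrC ler_wpM2l// norm_ge0.
Qed.

Lemma norm_le_normr u : N u <= norm_const * `|u|.
Proof.
apply: norm_le_coord => j; rewrite [leRHS]/Num.norm /= mx_normrE.
by apply: le_trans (le_bigmax _ _ (0, j)).
Qed.

Lemma norm_lip u v : `|N u - N v| <= norm_const * `|u - v|.
Proof.
apply: le_trans (norm_le_normr _); rewrite ler_norml.
have := norm_triangle hN (u - v) v; have := norm_triangle hN (v - u) u.
rewrite !subrK (normB v u) => h1 h2; apply/andP; split; lra.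
Qed.

Lemma is_norm_continuous : continuous N.
Proof.
move=> u A /nbhs_ballP[e /= e0 eA].
have k0 : 0 < norm_const + 1 by have := norm_const_ge0; lra.
have ek : 0 < e / (norm_const + 1) by rewrite divr_gt0.
suff : nbhs u (N @^-1` A) by [].
apply/nbhs_ballP; exists (e / (norm_const + 1)) => // v.
rewrite -ball_normE /= ltr_pdivlMr// => uv; apply: eA; rewrite -ball_normE /=.
apply: le_lt_trans (norm_lip _ _) _; apply: le_lt_trans uv.
by rewrite mulrC ler_wpM2l//; lra.
Qed.

(** Equivalence of norms: [N] is continuous, so it attains a positive minimum on the compact unit
    sphere of the sup norm, and homogeneity makes the inverse of this minimum a suitable [k]. The
    trivial space, whose sphere is empty, is treated apart. *)
Lemma coord_le_norm : exists2 k : R, 0 <= k &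
  forall (u : 'rV[R]_n) j, `|u 0 j| <= k * N u.
Proof.
have [[u0 u00]|triv] := pselect (exists u : 'rV[R]_n, u != 0);
  last first.
  exists 0 => // u j; rewrite mul0r.
  have -> : u = 0 by apply: contrapT => /eqP u0; apply: triv; exists u.
  by rewrite mxE normr0.
pose S := [set u : 'rV[R]_n | `|u| = 1].
have S0 : S !=set0.
  exists (`|u0|^-1 *: u0); rewrite /S /= normrZ normfV normr_id mulVf//.
  by rewrite normr_eq0.
have cS : compact S.
  apply: bounded_closed_compact.
    exists 1; split; first exact: num_real.
    by move=> x x1 u; rewrite /S /= => ->; exact: ltW.
  have -> : S = (@Num.norm _ 'rV[R]_n) @^-1` [set 1] by [].
  apply: closed_comp; last exact: closed_eq.
  by move=> x _; exact: norm_continuous.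
have [c cS1 cmin] := EVT_min_rV S0 cS (continuous_subspaceT is_norm_continuous).
have Nc : 0 < N c.
  rewrite lt_neqAle norm_ge0 andbT; apply/negP => /eqP/esym/(norm_definite hN) c0.
  by move: cS1; rewrite inE /S /= c0 normr0 => /esym/eqP; rewrite oner_eq0.
exists (N c)^-1; first by rewrite invr_ge0 ltW.
move=> u j; have uj : `|u 0 j| <= `|u|.
  rewrite [leRHS]/Num.norm /= mx_normrE.
  by apply: le_trans (le_bigmax _ _ (0, j)).
apply: le_trans uj _; rewrite mulrC ler_pdivlMr//.
have [->|u1] := eqVneq u 0; first by rewrite normr0 mul0r norm0.
have := cmin (`|u|^-1 *: u); rewrite inE (norm_homogeneous hN).
rewrite normfV normr_id [X in _ <= X]mulrC ler_pdivlMr ?normr_gt0//.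
rewrite [X in X <= _]mulrC; apply.
by rewrite /S /= normrZ normfV normr_id mulVf// normr_eq0.
Qed.

End norm.

(** * Measurability *)

Lemma measurable_ltr_set d (T : measurableType d) (R : realType) (f g : T -> R) :
  measurable_fun [set: T] f -> measurable_fun [set: T] g ->
  measurable [set t | f t < g t].
Proof.
move=> mf mg; rewrite -[X in measurable X]setTI.
by have := measurable_fun_ltr mf mg => /(_ measurableT [set true]); apply.
Qed.

Lemma measurable_ler_set d (T : measurableType d) (R : realType) (f g : T -> R) :
  measurable_fun [set: T] f -> measurable_fun [set: T] g ->
  measurable [set t | f t <= g t].
Proof.
move=> mf mg; rewrite -[X in measurable X]setTI.
by have := measurable_fun_ler mf mg => /(_ measurableT [set true]); apply.
Qed.

Section borel_rV.
Context (R : realType) (n : nat).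

Lemma measurable_continuous_rV (f : 'rV[R]_n -> R) :
  continuous f -> measurable_fun [set: borel_rV R n] (f : borel_rV R n -> R).
Proof.
move=> /continuousP cf; apply: (measurability _ (RGenOpens.measurableE R)).
move=> _ [_ [a [b ->] <-]]; rewrite setTI; apply: sub_sigma_algebra.
exact/cf/interval_open.
Qed.

(** An open set is the countable union of the balls with rational center and radius [k.+1%:R^-1]
    that it contains, and the preimage of such a ball is a finite intersection of conditions on
    coordinates. *)
Lemma measurable_rV d (T : measurableType d) (F : T -> borel_rV R n) :
  (forall j, measurable_fun [set: T] (fun t => (F t : 'rV[R]_n) 0 j)) ->
  measurable_fun [set: T] F.
Proof.
move=> mF.
apply: (@measurability _ _ T (borel_rV R n) setT F (@open 'rV[R]_n)) => //.
move=> _ [U oU <-].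
rewrite setTI.
pose B (p : 'rV[rat]_n * nat) := ball (map_mx ratr p.1 : 'rV[R]_n) p.2.+1%:R^-1.
have -> : F @^-1` U =
    \bigcup_p (if `[< B p `<=` U >] then F @^-1` (B p) else set0).
  apply/seteqP; split=> [t /= Ut|t [p _]]; last first.
    by case: asboolP => // BU /BU.
  have : nbhs (F t : 'rV[R]_n) U by exact: open_nbhs_nbhs.
  move=> /nbhs_ballP[e /= e0 eU].
  (* Half of [e], because a point of the ball is reached from [F t] through the rational center, at
     the cost of two radii. *)
  have [k ke] : exists k : nat, (k.+1%:R^-1 : R) < e / 2.
    have e20 : 0 < e / 2 by rewrite divr_gt0.
    have [k _ kP] := near_infty_natSinv_lt (PosNum e20).
    by exists k; apply: (kP k) => /=.
  have k0 : 0 < (k.+1%:R^-1 : R) by rewrite invr_gt0.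
  have /fin_all_exists[q qP] (j : 'I_n) : exists q : rat,
      `|(F t : 'rV[R]_n) 0 j - ratr q| < k.+1%:R^-1.
    have [|q] := @rat_in_itvoo R ((F t : 'rV[R]_n) 0 j - k.+1%:R^-1)
      ((F t : 'rV[R]_n) 0 j + k.+1%:R^-1).
      by rewrite ltrBlDr -addrA ltrDl addr_gt0.
    rewrite in_itv /= => /andP[q1 q2]; exists q.
    by rewrite distrC ltr_distl q1.
  have tB : B (\row_j q j, k) (F t).
    split=> // i j; rewrite ord1 !mxE -ball_normE /=.
    by rewrite distrC.
  exists (\row_j q j, k) => //; case: asboolP => // [[]] u Bu.
  apply: eU; move: tB Bu; rewrite /B -!ball_normE /= => tB Bu.
  apply: le_lt_trans (ler_distD (map_mx ratr (\row_j q j)) _ _) _.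
  rewrite distrC in tB; apply: lt_trans (ltrD tB Bu) _.
  by rewrite [ltRHS]splitr ltrD.
apply: countable_bigcupT_measurable => // -[q k].
case: asboolP => // _.
have -> : F @^-1` B (q, k) = \bigcap_(j in [set: 'I_n])
    [set t | `|ratr (q 0 j) - (F t : 'rV[R]_n) 0 j| < k.+1%:R^-1].
  apply/seteqP; split=> [t [_ tB] j _|t tB] /=.
    by have := tB 0 j; rewrite mxE -ball_normE.
  split=> [|i j]; first by rewrite invr_gt0.
  by rewrite ord1 mxE -ball_normE; exact: tB.
apply: fin_bigcap_measurable => // j _; apply: measurable_ltr_set => //.
by apply: measurableT_comp => //; apply: measurable_funB.
Qed.

Lemma measurable_is_norm_sub (N : 'rV[R]_n -> R) (c : 'rV[R]_n) : is_norm N ->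
  measurable_fun [set: borel_rV R n] (fun u : borel_rV R n => N ((u : 'rV[R]_n) - c)).
Proof.
move=> hN.
have mN : measurable_fun [set: borel_rV R n] (N : borel_rV R n -> R).
  by apply: measurable_continuous_rV; exact: is_norm_continuous.
suff : measurable_fun [set: borel_rV R n]
    (fun u : borel_rV R n => (u : 'rV[R]_n) - c : borel_rV R n).
  exact: (measurableT_comp mN).
apply: measurable_rV => j.
apply: (eq_measurable_fun (fun u : borel_rV R n => (u : 'rV[R]_n) 0 j - c 0 j)).
  by move=> u _; rewrite !mxE.
apply: measurable_funB => //.
by apply: measurable_continuous_rV; exact: coord_continuous.
Qed.

End borel_rV.

(** Meant for [c] the set of compatible neighbors: it takes finitely many values, and once it is
    fixed, rates and updates are explicit functions of the opinions. *)
Lemma measurable_fun_fincase d (T : measurableType d) (R : realType)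
    (F : finType) (c : T -> F) (g : F -> T -> R) :
  (forall a, measurable_fun [set: T] (fun t => c t == a)) ->
  (forall a, measurable_fun [set: T] (g a)) ->
  measurable_fun [set: T] (fun t => g (c t) t).
Proof.
move=> mc mg.
have -> : (fun t => g (c t) t) =
    (fun t => \sum_(a : F) if c t == a then g a t else 0).
  apply/funext => t; rewrite (bigD1 (c t)) //= eqxx big1 ?addr0 // => a.
  by rewrite eq_sym => /negbTE ->.
by apply: measurable_sum => a; exact: measurable_fun_ifT.
Qed.

Lemma measurable_bigmaxr d (T : measurableType d) (R : realType) (I : Type)
    (s : seq I) (h : I -> T -> R) :
  (forall i, measurable_fun [set: T] (h i)) ->
  measurable_fun [set: T] (fun t => \big[Num.max/0]_(i <- s) h i t).
Proof.
move=> mh; elim: s => [|i s ih].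
  by apply: (eq_measurable_fun (fun _ : T => 0 : R)) => // t _; rewrite big_nil.
apply: (eq_measurable_fun (fun t : T =>
  Num.max (h i t) (\big[Num.max/0]_(i <- s) h i t))).
  by move=> t _; rewrite big_cons.
exact: (measurable_maxr (mh i) ih).
Qed.

Lemma measurable_all d (T : measurableType d) (I : Type) (s : seq I)
    (h : I -> T -> bool) :
  (forall i, measurable_fun [set: T] (h i)) ->
  measurable_fun [set: T] (fun t => all (h ^~ t) s).
Proof. by move=> mh; elim: s => [|i s ih] //=; exact: measurable_and. Qed.

Section config_measurability.
Context (R : realType) (n : nat) (N : 'rV[R]_n -> R) (hN : is_norm N) (tau : R).
Context (V : finType) (E : rel V).
Notation mconfig := (mconfig V R n).

Lemma measurable_opinion x :
  measurable_fun [set: mconfig] (fun eta => eta x : borel_rV R n).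
Proof.
move=> _ B mB; rewrite setTI; apply: sub_sigma_algebra.
by exists x; exists B.
Qed.

Lemma measurable_opinion_coord x j :
  measurable_fun [set: mconfig] (fun eta => eta x 0 j).
Proof.
apply: (measurableT_comp (f := fun u : borel_rV R n => (u : 'rV[R]_n) 0 j)
  _ (measurable_opinion x)).
apply: measurable_continuous_rV; exact: coord_continuous.
Qed.

Lemma measurable_norm (F : mconfig -> borel_rV R n) :
  measurable_fun [set: mconfig] F ->
  measurable_fun [set: mconfig] (fun eta => N (F eta)).
Proof.
apply: measurableT_comp; apply: measurable_continuous_rV.
exact: is_norm_continuous.
Qed.

Lemma measurable_norm_diff x y :
  measurable_fun [set: mconfig] (fun eta => N (eta x - eta y)).
Proof.
apply: (measurable_norm (F := fun eta => eta x - eta y)).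
apply: measurable_rV => j.
apply: (eq_measurable_fun (fun eta : mconfig => eta x 0 j - eta y 0 j)).
  by move=> eta _; rewrite !mxE.
by apply: measurable_funB => //; exact: measurable_opinion_coord.
Qed.

Lemma measurable_norm_center x c :
  measurable_fun [set: mconfig] (fun eta => N (eta x - c)).
Proof.
exact: (measurableT_comp (measurable_is_norm_sub c hN) (measurable_opinion x)).
Qed.

Lemma measurable_discord :
  measurable_fun [set: mconfig] (fun eta : mconfig => discord N eta).
Proof.
apply: measurable_bigmaxr.
by move=> p; exact: measurable_norm_diff.
Qed.

Lemma measurable_compatible x A :
  measurable_fun [set: mconfig]
    (fun eta => compatible N tau E eta x == A).
Proof.
have my y : measurable_fun [set: mconfig]
    (fun eta => y \in compatible N tau E eta x).
  apply: (eq_measurable_fun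
    (fun eta : mconfig => E x y && (N (eta x - eta y) <= tau))).
    by move=> eta _; rewrite inE.
  apply: measurable_and => //; apply: measurable_fun_ler => //.
  exact: measurable_norm_diff.
apply: (eq_measurable_fun (fun eta : mconfig => all (fun y =>
    if y \in A then y \in compatible N tau E eta x
    else ~~ (y \in compatible N tau E eta x)) (enum V))).
  move=> eta _; apply/allP/eqP => [h|-> y _]; last by case: ifP => ->.
  apply/setP => y; have := h y (mem_enum _ _).
  by case: (y \in A) => // /negbTE.
apply: measurable_all => y; case: (y \in A) => //; exact: measurable_neg.
Qed.

Lemma measurable_update x :
  measurable_fun [set: mconfig] (update N tau E ^~ x : mconfig -> mconfig).
Proof.
apply: (@measurability _ _ mconfig mconfig setT _ (@cylinders V R n)) => //.
move=> _ [_ [z [B mB ->]] <-].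
rewrite setTI.
suff : measurable_fun [set: mconfig]
    (fun eta => update N tau E eta x z : borel_rV R n).
  by move=> /(_ measurableT B mB); rewrite setTI.
apply: measurable_rV => j; rewrite /update.
have [_|_] := eqVneq z x; last exact: measurable_opinion_coord.
apply: (@measurable_fun_fincase _ mconfig R {set V}
  (fun eta => compatible N tau E eta x)
  (fun A eta => (#|A|%:R^-1 *: \sum_(y in A) eta y) 0 j)).
  exact: measurable_compatible.
move=> A; apply: (eq_measurable_fun
    (fun eta : mconfig => #|A|%:R^-1 * \sum_(y <- enum A) eta y 0 j)).
  by move=> eta _; rewrite mxE summxE big_enum.
apply: measurable_funM => //.
by apply: measurable_sum => y; exact: measurable_opinion_coord.
Qed.

Lemma measurable_generator (f : mconfig -> R) :
  measurable_fun [set: mconfig] f ->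
  measurable_fun [set: mconfig] (generator N tau E f : mconfig -> R).
Proof.
move=> mf; apply: measurable_sum => x.
apply: (@measurable_fun_fincase _ mconfig R {set V}
  (fun eta => compatible N tau E eta x)
  (fun A eta => #|A|%:R * (f (update N tau E eta x) - f eta))).
  exact: measurable_compatible.
move=> A; apply: measurable_funM => //; apply: measurable_funB => //.
exact: (measurableT_comp mf (measurable_update x)).
Qed.

End config_measurability.

(** * First order expansion of the semigroup *)

Section semigroup.
Context (R : realType) (n : nat) (N : 'rV[R]_n -> R) (tau : R).
Context (V : finType) (E : rel V).
Notation config := (V -> 'rV[R]_n).
Notation compatible := (compatible N tau E).
Notation update := (update N tau E).
Notation generator := (generator N tau E).
Notation semigroup := (semigroup N tau E).
Implicit Types (f : config -> R) (eta : config) (M t h : R).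

(** Bounds the norm of the generator on bounded functions: [#|V|] vertices, each with rate at most
    [#|V|], and a difference of two values of the function. *)
Definition rate_bound : R := (#|V| * #|V|)%:R * 2.

Lemma rate_bound_ge0 : 0 <= rate_bound. Proof. by rewrite mulr_ge0. Qed.

(** The bound is asked only at [eta] and at the configurations reached by an actual jump, so that it
    applies to functions controlled only on a set stable under updates. *)
Lemma generator_le_at f M eta : `|f eta| <= M ->
  (forall x, #|compatible eta x| != 0%N -> `|f (update eta x)| <= M) ->
  `|generator f eta| <= rate_bound * M.
Proof.
move=> feta fup; apply: le_trans (ler_norm_sum _ _ _) _.
have -> : rate_bound * M = \sum_(x : V) #|V|%:R * (2 * M).
  by rewrite sumr_const /rate_bound natrM; ring.
apply: ler_sum => x _; rewrite normrM normr_nat.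
have [->|c0] := eqVneq #|compatible eta x| 0%N.
  by rewrite mul0r !mulr_ge0 // (le_trans _ feta).
apply: ler_pM => //; first by rewrite ler_nat max_card.
apply: le_trans (ler_normB _ _) _; have := fup _ c0; lra.
Qed.

Lemma generator_le f M : (forall eta, `|f eta| <= M) ->
  forall eta, `|generator f eta| <= rate_bound * M.
Proof. by move=> fM eta; exact: generator_le_at. Qed.

Lemma iter_generator_le f M k : (forall eta, `|f eta| <= M) ->
  forall eta, `|iter k generator f eta| <= rate_bound ^+ k * M.
Proof.
move=> fM; elim: k => [|k ih] eta /=; first by rewrite mul1r.
by rewrite exprS -mulrA; exact: generator_le.
Qed.

Lemma semigroup_term_le f M t k eta : (forall eta, `|f eta| <= M) ->
  `|t ^+ k / k`!%:R * iter k generator f eta| <=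
  M * exp_coeff (`|t| * rate_bound) k.
Proof.
move=> fM; rewrite /exp_coeff /= !normrM normfV normrX normr_nat exprMn.
have -> : M * (`|t| ^+ k * rate_bound ^+ k / k`!%:R) =
  `|t| ^+ k / k`!%:R * (rate_bound ^+ k * M) by ring.
rewrite ler_wpM2l ?mulr_ge0 ?invr_ge0 ?exprn_ge0//.
exact: iter_generator_le.
Qed.

(** Absolute convergence, by comparison with the exponential series at [|t| * rate_bound]. *)
Lemma semigroup_cvg f M t eta : (forall eta, `|f eta| <= M) ->
  series (fun k => t ^+ k / k`!%:R * iter k generator f eta) @ \oo -->
  semigroup t f eta.
Proof.
move=> fM; suff : cvgn (series (fun k => t ^+ k / k`!%:R * iter k generator f eta)).
  by [].
apply: normed_cvg.
apply: (@series_le_cvg _ _ (fun k => M * exp_coeff (`|t| * rate_bound) k)).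
- by move=> k /=; exact: normr_ge0.
- move=> k; rewrite mulr_ge0 ?exp_coeff_ge0 ?mulr_ge0 ?rate_bound_ge0//.
  exact: le_trans (normr_ge0 _) (fM eta).
- by move=> k; exact: semigroup_term_le.
- by apply: is_cvg_seriesZ; exact: is_cvg_series_exp_coeff.
Qed.

(** The left-hand side is the tail of the exponential series from [k = 2] on, where
    [h ^+ k <= h ^+ 2]; what remains is dominated by the series of [expR rate_bound]. *)
Lemma semigroup_first_order f M h eta : 0 <= h <= 1 ->
  (forall eta, `|f eta| <= M) ->
  `|semigroup h f eta - f eta - h * generator f eta| <=
  h ^+ 2 * (expR rate_bound * M).
Proof.
move=> /andP[h0 h1] fM.
set u := fun k => h ^+ k / k`!%:R * iter k generator f eta.
have M0 : 0 <= M by exact: le_trans (normr_ge0 _) (fM eta).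
have cvgS : (fun m => `|series u m - f eta - h * generator f eta|) @ \oo -->
    `|semigroup h f eta - f eta - h * generator f eta|.
  by apply: cvg_norm; apply: cvgB; [apply: cvgB; [exact: semigroup_cvg|]|];
    exact: cvg_cst.
rewrite -(cvg_lim (@Rhausdorff R) cvgS).
apply: limr_le; first by apply/cvg_ex; eexists; exact: cvgS.
exists 2%N => // m /= m2.
have -> : series u m - f eta - h * generator f eta = \sum_(2 <= k < m) u k.
  rewrite /series /= (@big_cat_nat _ _ _ 2) //= big_nat_recl // big_nat1.
  rewrite /u /= (_ : 0`! = 1%N) // (_ : 1`! = 1%N) // invr1; ring.
apply: le_trans (ler_norm_sum _ _ _) _.
apply: (@le_trans _ _ (\sum_(2 <= k < m) h ^+ 2 * M * exp_coeff rate_bound k)).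
  rewrite !big_nat; apply: ler_sum => k /andP[k2 _].
  apply: le_trans (semigroup_term_le _ _ _ fM) _.
  have -> : M * exp_coeff (`|h| * rate_bound) k =
      h ^+ k * (M * exp_coeff rate_bound k).
    by rewrite ger0_norm // /exp_coeff /= exprMn; ring.
  rewrite -mulrA ler_wpM2r ?mulr_ge0 ?exprn_ge0 ?rate_bound_ge0//.
  exact: ler_wiXn2l.
rewrite -mulr_sumr -mulrA ler_wpM2l ?exprn_ge0// mulrC ler_wpM2r//.
apply: (@le_trans _ _ (series (exp_coeff rate_bound) m)).
  rewrite /series /= [leRHS](@big_cat_nat _ _ _ 2) //=.
  apply: ler_wpDl => //; apply: sumr_ge0 => k _; exact: exp_coeff_ge0 rate_bound_ge0.
apply: nondecreasing_cvgn_le; last exact: is_cvg_series_exp_coeff.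
apply/nondecreasing_seqP => k; rewrite seriesSr lerDl.
exact: exp_coeff_ge0 rate_bound_ge0.
Qed.

Lemma measurable_semigroup (hN : is_norm N) f M t :
  measurable_fun [set: mconfig V R n] f -> (forall eta, `|f eta| <= M) ->
  measurable_fun [set: mconfig V R n] (semigroup t f : mconfig V R n -> R).
Proof.
move=> mf fM; apply: (measurable_fun_cvg (h := fun m (eta : mconfig V R n) =>
  series (fun k => t ^+ k / k`!%:R * iter k generator f eta) m)).
  move=> m; apply: measurable_sum => k; apply: measurable_funM => //.
  by elim: k => [//|k ih] /=; exact: measurable_generator.
by move=> eta _; exact: semigroup_cvg.
Qed.

(** On a set that no jump leaves, each iterate of the generator only sees values of [f] inside the
    set, so the series vanishes term by term. *)
Lemma semigroup_closed_eq0 (A : set config) f t :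
  (forall eta x, A eta -> #|compatible eta x| != 0%N -> A (update eta x)) ->
  (forall eta, A eta -> f eta = 0) -> forall eta, A eta -> semigroup t f eta = 0.
Proof.
move=> Aup fA eta Aeta.
have iter0 k : forall eta, A eta -> iter k generator f eta = 0.
  elim: k => [//|k ih] {Aeta}eta Aeta /=; rewrite /generator big1 // => x _.
  have [->|c0] := eqVneq #|compatible eta x| 0%N.
    by rewrite mul0r.
  by rewrite !ih ?subr0 ?mulr0//; exact: Aup.
rewrite /semigroup (_ : series _ = fun=> 0) ?lim_cst//.
by apply/funext => m; rewrite /series /= big1 // => k _; rewrite iter0 // mulr0.
Qed.

End semigroup.

(** * Lyapunov functions and dissipation *)

Section lyapunov.
Context (R : realType) (n : nat) (N : 'rV[R]_n -> R) (hN : is_norm N) (tau : R).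
Context (V : finType) (E : rel V) (hG : simple_connected_graph E).
Notation config := (V -> 'rV[R]_n).
Notation compatible := (compatible N tau E).
Notation update := (update N tau E).
Notation generator := (generator N tau E).
Implicit Types (eta : config) (x y z : V).

Lemma compatible_sym eta x y : (y \in compatible eta x) = (x \in compatible eta y).
Proof. by rewrite !inE (graph_sym hG) (normB hN). Qed.

(** Compatibility is symmetric, so each edge contributes two opposite differences. This cancellation
    underlies all the conservation laws below. *)
Lemma sum_compatible_diff eta (a : V -> R) :
  \sum_x \sum_(y in compatible eta x) (a y - a x) = 0.
Proof.
under eq_bigr do rewrite sumrB.
rewrite sumrB (exchange_big_dep predT) //=.
apply/eqP; rewrite subr_eq0; apply/eqP; apply: eq_bigr => x _.
by apply: eq_bigl => y; rewrite compatible_sym.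
Qed.

Lemma update_sum eta x (U : zmodType) (F : 'rV[R]_n -> U) :
  \sum_z F (update eta x z) = \sum_z F (eta z) + (F (update eta x x) - F (eta x)).
Proof.
rewrite (bigD1 x) //= [in RHS](bigD1 x) //= addrC.
have -> : \sum_(z | z != x) F (update eta x z) = \sum_(z | z != x) F (eta z).
  by apply: eq_bigr => z zx; rewrite /Defs.update (negbTE zx).
by rewrite [RHS]addrC addrA subrK addrC.
Qed.

(* Junk at isolated vertices, where the factor [#|compatible eta x|] in front
   of it vanishes. *)
Definition displacement eta x j : R := update eta x x 0 j - eta x 0 j.

(** Rate times displacement is the Laplacian of the graph of compatible edges. *)
Lemma card_displacement eta x j : #|compatible eta x|%:R * displacement eta x j =
  \sum_(y in compatible eta x) (eta y 0 j - eta x 0 j).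
Proof.
rewrite sumrB sumr_const /displacement /Defs.update eqxx mxE summxE.
have [c0|c0] := eqVneq #|compatible eta x| 0%N.
  by rewrite c0 mul0r mulr0n subr0 big1 // => y; rewrite (card0_eq c0).
by rewrite mulrBr mulVKf ?pnatr_eq0// mulr_natl.
Qed.

(** Jensen's inequality for [N], multiplied by the jump rate to match the terms of the generator. *)
Lemma norm_update_sub_le (u : 'rV[R]_n) eta x : #|compatible eta x| != 0%N ->
  #|compatible eta x|%:R * N (update eta x x - u) <=
  \sum_(y in compatible eta x) N (eta y - u).
Proof.
move=> c0; rewrite /Defs.update eqxx.
set k := #|_| in c0 *; have k0 : (0 : R) < k%:R by rewrite ltr0n lt0n.
have -> : k%:R^-1 *: \sum_(y in compatible eta x) eta y - u =
    k%:R^-1 *: \sum_(y in compatible eta x) (eta y - u).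
  rewrite sumrB sumr_const scalerBr; congr (_ - _).
  by rewrite -[u *+ _]scaler_nat scalerA mulVf ?scale1r// gt_eqF.
rewrite (norm_homogeneous hN) ger0_norm ?invr_ge0 ?(ltW k0)//.
by rewrite mulrA divff ?gt_eqF// mul1r; exact: norm_sum.
Qed.

(** Jensen's inequality bounds the drift at [x] by the differences of [N (_ - c)] along the
    compatible edges at [x], and these cancel in the sum over [x]. *)
Lemma generator_norm_center_le0 (c : 'rV[R]_n) eta :
  generator (fun eta => \sum_x N (eta x - c)) eta <= 0.
Proof.
rewrite -[leRHS](sum_compatible_diff eta (fun x => N (eta x - c))).
apply: ler_sum => x _ /=.
have /= -> := update_sum eta x (fun u => N (u - c)).
rewrite addrC addKr sumrB sumr_const.
have [c0|c0] := eqVneq #|compatible eta x| 0%N.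
  by rewrite c0 mul0r mulr0n subr0 big1 // => y; rewrite (card0_eq c0).
by rewrite mulrBr [X in _ - X <= _]mulr_natl lerD2r norm_update_sub_le.
Qed.

Definition dissipation eta : R :=
  \sum_x \sum_j #|compatible eta x|%:R * displacement eta x j ^+ 2.

Lemma dissipation_ge0 eta : 0 <= dissipation eta.
Proof.
by apply: sumr_ge0 => x _; apply: sumr_ge0 => j _; rewrite mulr_ge0 ?sqr_ge0.
Qed.

(* The cross terms of the square vanish because every coordinate of the total
   opinion is a martingale. *)
Lemma generator_total_sqr eta :
  generator (fun eta => \sum_j (\sum_x eta x 0 j) ^+ 2) eta = dissipation eta.
Proof.
pose S j := \sum_x eta x 0 j.
have -> : dissipation eta = dissipation eta +
    \sum_j 2 * S j * \sum_x \sum_(y in compatible eta x) (eta y 0 j - eta x 0 j).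
  rewrite big1 ?addr0// => j _.
  by rewrite (sum_compatible_diff eta (fun x => eta x 0 j)) mulr0.
under [in RHS]eq_bigr do rewrite mulr_sumr.
rewrite [X in _ + X]exchange_big /= /dissipation -big_split /=.
apply: eq_bigr => x _; rewrite -big_split -sumrB mulr_sumr; apply: eq_bigr => j _ /=.
rewrite -card_displacement; have /= -> := update_sum eta x (fun u => u 0 j).
by rewrite -/(S j) -/(displacement eta x j); ring.
Qed.

(* By symmetry the Dirichlet energy equals [- 2 * \sum_x eta x * (L eta) x],
   with [L] the Laplacian of the graph of compatible edges. *)
Lemma dirichlet_energy_le eta j (M g : R) : (forall x, `|eta x 0 j| <= M) ->
  (forall x, `|#|compatible eta x|%:R * displacement eta x j| <= g) ->
  \sum_x \sum_(y in compatible eta x) (eta y 0 j - eta x 0 j) ^+ 2 <=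
  2 * #|V|%:R * M * g.
Proof.
move=> etaM dg.
have -> : \sum_x \sum_(y in compatible eta x) (eta y 0 j - eta x 0 j) ^+ 2 =
    \sum_x - 2 * eta x 0 j * (#|compatible eta x|%:R * displacement eta x j).
  rewrite -[RHS]add0r -[X in X + _](sum_compatible_diff eta (fun x => eta x 0 j ^+ 2)).
  rewrite -big_split; apply: eq_bigr => x _ /=.
  rewrite card_displacement mulr_sumr -big_split /=; apply: eq_bigr => y _; ring.
have -> : 2 * #|V|%:R * M * g = \sum_(x : V) 2 * M * g.
  by rewrite sumr_const -mulr_natl; ring.
apply: ler_sum => x _; apply: le_trans (ler_norm _) _.
rewrite normrM ler_pM// normrM normrN normr_nat ler_wpM2l//.
Qed.

Lemma path_close eta j x p (rho : R) :
  (forall x y, y \in compatible eta x -> `|eta y 0 j - eta x 0 j| <= rho) ->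
  path (fun x y => y \in compatible eta x) x p ->
  `|eta (last x p) 0 j - eta x 0 j| <= (size p)%:R * rho.
Proof.
move=> erho; elim: p x => [|y p ih] x /=; first by rewrite subrr normr0 mul0r.
move=> /andP[xy /ih{}ih]; apply: le_trans (ler_distD (eta y 0 j) _ _) _.
by rewrite -natr1 mulrDl mul1r lerD// erho.
Qed.

(** Small dissipation makes the Laplacian at most [g], hence the Dirichlet energy at most
    [rho ^+ 2], hence each compatible edge at most [rho] long in every coordinate; simple paths have
    fewer than [#|V|] edges. *)
Lemma dissipation_small_close (M e : R) : 0 < e -> exists2 dl : R, 0 < dl &
  forall eta, (forall x j, `|eta x 0 j| <= M) -> dissipation eta <= dl ->
  forall x y, connect (fun x y => y \in compatible eta x) x y ->
    N (eta x - eta y) <= e.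
Proof.
move=> e0; have C0 := norm_const_ge0 hN.
have v0 : (0 : R) <= #|V|%:R by [].
(* The constants are chosen backwards from [e]; each added 1 keeps a denominator positive when the
   other term vanishes. *)
pose rho := e / (norm_const N * #|V|%:R + 1).
have den1 : 0 < norm_const N * #|V|%:R + 1 by rewrite ltr_pwDr// mulr_ge0.
have rho0 : 0 < rho by rewrite divr_gt0.
pose g := rho ^+ 2 / (2 * #|V|%:R * `|M| + 1).
have den2 : 0 < 2 * #|V|%:R * `|M| + 1 by rewrite ltr_pwDr// !mulr_ge0.
have g0 : 0 < g by rewrite divr_gt0// exprn_gt0.
have den3 : 0 < #|V|%:R + 1 :> R by rewrite ltr_pwDr.
exists (g ^+ 2 / (#|V|%:R + 1)); first by rewrite divr_gt0// exprn_gt0.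
move=> eta etaM Dle x y /connectP[p /shortenP[q xq uq _] ->] {p y}.
have dg z j : `|#|compatible eta z|%:R * displacement eta z j| <= g.
  rewrite -(ler_pXn2r (n := 2)) ?nnegrE ?(ltW g0)// -normrX ger0_norm ?sqr_ge0//.
  have Dz : #|compatible eta z|%:R * displacement eta z j ^+ 2 <=
      g ^+ 2 / (#|V|%:R + 1).
    apply: le_trans Dle; rewrite /dissipation (bigD1 z) //= (bigD1 j) //= -addrA.
    rewrite lerDl addr_ge0// sumr_ge0// => k _; last first.
      by apply: sumr_ge0 => i _; rewrite mulr_ge0 ?sqr_ge0.
    by rewrite mulr_ge0 ?sqr_ge0.
  have cV : #|compatible eta z|%:R <= #|V|%:R + 1 :> R.
    by rewrite natr1 ler_nat ltnW// ltnS max_card.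
  (* The dissipation carries one factor of the rate and the squared Laplacian two; the missing one
     is at most [#|V|%:R + 1]. *)
  have := ler_pM (ler0n _ _) _ cV Dz; rewrite mulr_ge0 ?sqr_ge0// => /(_ isT).
  rewrite [X in _ <= X]mulrC divfK ?gt_eqF//; apply: le_trans.
  by rewrite le_eqVlt; apply/orP; left; apply/eqP; ring.
have edge j z z' : z' \in compatible eta z -> `|eta z' 0 j - eta z 0 j| <= rho.
  move=> zz'.
  rewrite -(ler_pXn2r (n := 2)) ?nnegrE ?(ltW rho0)// -normrX ger0_norm ?sqr_ge0//.
  have := @dirichlet_energy_le eta j `|M| g.
  move=> /(_ (fun x => le_trans (etaM x j) (ler_norm _)) (fun x => dg x j)).
  rewrite (bigD1 z) //= (bigD1 z') //= -addrA => en.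
  have en2 : 2 * #|V|%:R * `|M| * g <= rho ^+ 2.
    rewrite /g mulrCA -[leRHS]mulr1 ler_wpM2l ?sqr_ge0//.
    by rewrite ler_pdivrMr// mul1r lerDl.
  apply: le_trans en2; apply: le_trans en.
  rewrite lerDl addr_ge0// sumr_ge0// => k _; first exact: sqr_ge0.
  by apply: sumr_ge0 => i _; exact: sqr_ge0.
have sq : (size q)%:R <= #|V|%:R :> R.
  by rewrite ler_nat ltnW//; have := card_uniqP uq => /= <-; exact: max_card.
have := @norm_le_coord _ _ _ hN (eta x - eta (last x q)) (#|V|%:R * rho).
move=> /(_ _)/le_trans; apply.
  move=> j; rewrite !mxE distrC; apply: le_trans (path_close (edge j) xq) _.
  by rewrite ler_wpM2r// ltW.
rewrite mulrA /rho mulrCA -[leRHS]mulr1 ler_wpM2l ?ltW//.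
by rewrite ltr_pdivrMr// mul1r ltrDl.
Qed.

(** When the compatible graph is disconnected, connectedness of [E] provides an edge leaving the
    component of [x]. Its outer end is within [r] of [c] and its inner end more than [tau] away from
    it, while [x] is within [e] of the inner end. *)
Lemma consensus_or_far (Delta : set 'rV[R]_n) (c : 'rV[R]_n) (r e : R) eta :
  (forall a, Delta a -> N (a - c) <= r) -> (forall x, Delta (eta x)) -> 0 <= e ->
  (forall x y, connect (fun x y => y \in compatible eta x) x y ->
    N (eta x - eta y) <= e) ->
  discord N eta <= e \/ forall x, tau - r - e <= N (eta x - c).
Proof.
move=> cr De e0 close; set comp := fun x y => y \in compatible eta x.
have comp_sym : connect_sym comp.
  apply: sym_connect_sym => x y; exact: compatible_sym.
have [allc|/existsNP[x0 /existsNP[y0 /negP nc]]] :=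
  pselect (forall x y, connect comp x y).
  by left; apply: bigmax_le => // p _; exact: close.
right=> x.
have [z xz] : exists z, ~~ connect comp x z.
  have [xx0|] := boolP (connect comp x x0); last by exists x0.
  exists y0; apply: contra nc; apply: connect_trans.
  by rewrite comp_sym.
(* Otherwise the component of [x] would be closed under [E] and would contain [z]. *)
have [u [v [xu xv uv]]] : exists u v, [/\ connect comp x u, ~~ connect comp x v
    & E u v].
  apply: contrapT => no.
  have cl : fingraph.closed E (connect comp x).
    move=> u v uv; apply/idP/idP => h; apply: contrapT => /negP h'; apply: no.
      by exists u, v.
    by exists v, u; rewrite (graph_sym hG).
  have := closed_connect cl (graph_connected hG x z).
  by rewrite /in_mem /= connect0 (negbTE xz).
have tuv : tau < N (eta u - eta v).
  rewrite ltNge; apply: contra xv => uvt; apply: connect_trans xu _.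
  by apply: connect1; rewrite /comp inE uv.
have := norm_triangle hN (eta u - c) (c - eta v).
have := norm_triangle hN (eta u - eta x) (eta x - c).
rewrite !addrA !subrK (normB hN c) (normB hN (eta u) (eta x)).
by have := close _ _ xu; have := cr _ (De v); lra.
Qed.

(** The new opinion is an average of old ones, so its distance to any old opinion is at most an
    average of old distances. *)
Lemma discord_update eta x : #|compatible eta x| != 0%N ->
  discord N (update eta x) <= discord N eta.
Proof.
move=> c0; have d0 : 0 <= discord N eta by exact: bigmax_ge_id.
have dd y z : N (eta y - eta z) <= discord N eta.
  exact: (le_bigmax _ (fun p => N (eta p.1 - eta p.2)) (y, z)).
have k0 : (0 : R) < #|compatible eta x|%:R by rewrite ltr0n lt0n.
have dx z : N (update eta x x - eta z) <= discord N eta.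
  rewrite -(ler_pM2l k0) [leRHS]mulr_natl -[leRHS]sumr_const.
  by apply: le_trans (norm_update_sub_le _ c0) _; exact: ler_sum.
apply: bigmax_le => // -[y z] _ /=.
have [->|yx] := eqVneq y x; have [->|zx] := eqVneq z x.
- by rewrite subrr (norm0 hN).
- by rewrite [X in _ - X](_ : _ = eta z) // /Defs.update (negbTE zx).
- by rewrite (normB hN) [X in _ - X](_ : _ = eta y) // /Defs.update (negbTE yx).
- by rewrite /Defs.update (negbTE zx) (negbTE yx).
Qed.

(** A pointwise form of the dichotomy, ready for taking expectations: a large dissipation is paid
    for by the term in [K], and otherwise a large discord forces every opinion away from [c]. *)
Lemma far_indicator_le (Delta : set 'rV[R]_n) (c : 'rV[R]_n) (r M e : R) :
  (forall a, Delta a -> N (a - c) <= r) -> r < tau ->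
  (forall a j, Delta a -> `|a 0 j| <= M) -> 0 < e ->
  exists2 K, 0 <= K & forall eta, (forall x, Delta (eta x)) ->
    (e < discord N eta)%R%:R * (tau - r) <=
    #|V|%:R^-1 * (\sum_x N (eta x - c)) + e + K * dissipation eta.
Proof.
move=> cr rt DM e0; have tr0 : 0 < tau - r by rewrite subr_gt0.
have [dl dl0 close] := dissipation_small_close M e0.
(* With this [K], a dissipation above the threshold [dl] already contributes [tau - r]. *)
exists ((tau - r) / dl); first by rewrite divr_ge0// ltW.
move=> eta De; set A := #|V|%:R^-1 * _.
have A0 : 0 <= A by rewrite mulr_ge0// sumr_ge0// => x _; exact: norm_ge0.
have KD0 : 0 <= (tau - r) / dl * dissipation eta.
  by rewrite mulr_ge0 ?dissipation_ge0// divr_ge0// ltW.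
have [ed|_] := ltP e (discord N eta); last by rewrite mul0r !addr_ge0// ltW.
rewrite mul1r; have [Dle|Dgt] := leP (dissipation eta) dl; last first.
  have : tau - r <= (tau - r) / dl * dissipation eta.
    by rewrite mulrAC ler_pdivlMr// ler_pM2l// ltW.
  by lra.
have etaM x j : `|eta x 0 j| <= M by exact: DM.
have [|far] := consensus_or_far cr De (ltW e0) (close _ etaM Dle).
  by rewrite leNgt ed.
suff : tau - r - e <= A by lra.
(* Without vertices the discord is 0, the default value of the maximum, and cannot exceed [e]. *)
have V0 : (0 < #|V|)%N.
  rewrite lt0n; apply: contraTneq ed => V0; rewrite -leNgt.
  by apply: bigmax_le => [|[x y] _]; [exact: ltW|have := fintype0 x V0].
rewrite /A mulrC ler_pdivlMr ?ltr0n// mulr_natr -sumr_const.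
exact: ler_sum.
Qed.

End lyapunov.

(** * Convex means, expectations of bounded functions, linearity of the generator *)

Lemma exists_natmul_gt (R : realType) (c e : R) :
  0 < e -> exists k : nat, c < e * k.+1%:R.
Proof.
move=> e0; exists (Num.bound `|c / e|); rewrite mulrC -ltr_pdivrMr//.
apply: le_lt_trans (ler_norm _) _.
by apply: lt_le_trans (archi_boundP _) _ => //; rewrite ler_nat.
Qed.

(** Induction on the list of points: the mean is a convex combination of the first point, with
    weight the inverse of the length, and of the mean of the others. A singleton is apart, since the
    mean of an empty list is the junk value 0. *)
Lemma convex_mean (R : realType) (n : nat) (Delta : set 'rV[R]_n) (V : finType)
    (A : {set V}) (F : V -> 'rV[R]_n) :
  convex_set (Delta : set (convex_lmodType 'rV[R]_n)) -> #|A| != 0%N ->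
  (forall y, y \in A -> Delta (F y)) ->
  Delta (#|A|%:R^-1 *: \sum_(y in A) F y).
Proof.
move=> cD A0 AF; rewrite -big_enum /= cardE.
rewrite cardE in A0.
have {}AF y : y \in enum A -> Delta (F y) by rewrite mem_enum; exact: AF.
elim: (enum A) A0 AF => [//|y s ih _] AF; rewrite big_cons /=.
have [s0|s0] := eqVneq (size s) 0%N.
  rewrite (size0nil s0) big_nil invr1 scale1r addr0.
  by apply: AF; rewrite mem_head.
have {}ih : Delta ((size s)%:R^-1 *: \sum_(z <- s) F z).
  by apply: ih => // z zs; apply: AF; rewrite inE zs orbT.
have p0 : 0 <= ((size s).+1%:R^-1 : R) by rewrite invr_ge0.
have p1 : ((size s).+1%:R^-1 : R) <= 1 by rewrite invf_le1// ler1n.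
have := cD (F y) ((size s)%:R^-1 *: \sum_(z <- s) F z) (Itv01 p0 p1).
rewrite !inE => /(_ (AF _ (mem_head _ _)) ih).
congr Delta; rewrite scalerDr; congr (_ + _); rewrite scalerA; congr (_ *: _).
rewrite /unstable.onem /=.
by field; rewrite nat1r !pnatr_eq0 s0.
Qed.

Section bounded_expectation.
Context d (T : measurableType d) (R : realType) (P : probability T R).
Implicit Types g : T -> R.

Lemma bounded_integrable g M : measurable_fun [set: T] g ->
  (forall w, `|g w| <= M) -> P.-integrable [set: T] (EFin \o g).
Proof.
move=> mg gM; apply: measurable_bounded_integrable => //.
  by rewrite ltey_eq fin_num_measure.
exists M; split; first exact: num_real.
by move=> x Mx w _; apply: le_trans (gM w) _; exact: ltW.
Qed.

Lemma Rintegral_indic (A : set T) : measurable A ->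
  \int[P]_w (\1_A w : R) = fine (P A).
Proof. by move=> mA; rewrite /Rintegral integral_indic// setIT. Qed.

Lemma Rintegral_prob_cst (c : R) : \int[P]_w c = c.
Proof.
rewrite Rintegral_cst// [X in fine X](_ : _ = 1%E) ?mulr1//.
exact: probability_setT.
Qed.

End bounded_expectation.

Section generator_linear.
Context (R : realType) (n : nat) (N : 'rV[R]_n -> R) (tau : R).
Context (V : finType) (E : rel V).
Notation config := (V -> 'rV[R]_n).
Notation generator := (generator N tau E).
Implicit Types (f g : config -> R) (eta : config).

Lemma generatorB f g eta :
  generator (fun eta => f eta - g eta) eta = generator f eta - generator g eta.
Proof. by rewrite /generator -sumrB; apply: eq_bigr => x _; ring. Qed.

Lemma generatorZ (a : R) f eta :
  generator (fun eta => a * f eta) eta = a * generator f eta.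
Proof. by rewrite /generator mulr_sumr; apply: eq_bigr => x _; ring. Qed.

Lemma generator_sum (I : Type) (s : seq I) (F : I -> config -> R) eta :
  generator (fun eta => \sum_(i <- s) F i eta) eta =
  \sum_(i <- s) generator (F i) eta.
Proof.
rewrite /generator exchange_big /=; apply: eq_bigr => x _.
by rewrite -sumrB mulr_sumr.
Qed.

End generator_linear.

(** * Expectations along the process *)

Section HK_expectation.
Context (R : realType) (n : nat) (N : 'rV[R]_n -> R) (hN : is_norm N).
Context (Delta : set 'rV[R]_n).
Hypothesis Delta_convex : convex_set (Delta : set (convex_lmodType 'rV[R]_n)).
Context (tau : R) (V : finType) (E : rel V).
Context (d : measure_display) (T : measurableType d) (P : probability T R).
Context (xi : R -> T -> V -> 'rV[R]_n).
Hypothesis hxi : Hegselmann_Krause N Delta tau E P xi.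

Notation config := (V -> 'rV[R]_n).
Notation mconfig := (mconfig V R n).
Notation compatible := (compatible N tau E).
Notation update := (update N tau E).
Notation generator := (generator N tau E).
Notation semigroup := (semigroup N tau E).
Notation Lambda := (rate_bound R V).
Implicit Types (f g : config -> R) (eta : config) (s t h M : R) (B : set mconfig).

Definition state_space : set config := [set eta | forall x, Delta (eta x)].

Lemma state_space_update eta x : state_space eta ->
  #|compatible eta x| != 0%N -> state_space (update eta x).
Proof.
move=> De c0 z; rewrite /Defs.update; case: ifP => // _.
exact: convex_mean.
Qed.

Lemma state_space_xi t w : 0 <= t -> state_space (xi t w).
Proof. by move=> t0 x; exact: HK_opinions hxi t w x t0. Qed.

(** Restricted to the state space because the Lyapunov functions are in general unbounded on all
    configurations. *)
Definition bounded_by f M := forall eta, state_space eta -> `|f eta| <= M.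

Definition observable f :=
  measurable_fun [set: mconfig] (f : mconfig -> R) /\ exists M, bounded_by f M.

Definition mean f t := \int[P]_w f (xi t w).

Lemma observable_integrable f t : 0 <= t -> observable f ->
  P.-integrable [set: T] (EFin \o (fun w => f (xi t w))).
Proof.
move=> t0 [mf [M fM]]; apply: (@bounded_integrable _ _ _ _ _ M).
  exact: (measurableT_comp mf (HK_measurable hxi t0)).
by move=> w; apply/fM/state_space_xi.
Qed.

Lemma observable_cst c : observable (fun=> c).
Proof. by split=> //; exists `|c|. Qed.

Lemma observableD f g : observable f -> observable g ->
  observable (fun eta => f eta + g eta).
Proof.
move=> [mf [M fM]] [mg [K gK]]; split; first exact: measurable_funD.
exists (M + K) => eta De; apply: le_trans (ler_normD _ _) _.
by apply: lerD; [exact: fM|exact: gK].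
Qed.

Lemma observableZ c f : observable f -> observable (fun eta => c * f eta).
Proof.
move=> [mf [M fM]]; split; first exact: measurable_funM.
by exists (`|c| * M) => eta De; rewrite normrM ler_wpM2l// fM.
Qed.

Lemma observableB f g : observable f -> observable g ->
  observable (fun eta => f eta - g eta).
Proof.
move=> of_ og; have := observableD of_ (observableZ (-1) og).
by under [X in observable X -> _]eq_fun do rewrite mulN1r.
Qed.

Lemma observable_sum (I : Type) (s : seq I) (F : I -> config -> R) :
  (forall i, observable (F i)) -> observable (fun eta => \sum_(i <- s) F i eta).
Proof.
move=> oF; elim: s => [|i s ih].
  by under eq_fun do rewrite big_nil; exact: observable_cst.
under eq_fun do rewrite big_cons.
exact: observableD.
Qed.

Lemma observable_indic B : measurable B -> observable \1_B.
Proof.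
move=> mB; split; first exact: measurable_indic.
by exists 1 => eta _; rewrite indicE normr_nat lern1 leq_b1.
Qed.

Lemma observable_generator f : observable f -> observable (generator f).
Proof.
move=> [mf [M fM]]; split; first exact: measurable_generator.
exists (Lambda * M) => eta De; apply: generator_le_at; first exact: fM.
by move=> x c0; apply/fM/state_space_update.
Qed.

Lemma observable_semigroup_indic t B : measurable B ->
  observable (semigroup t \1_B).
Proof.
move=> mB.
have B1 eta : `|\1_B eta : R| <= 1 by rewrite indicE normr_nat lern1 leq_b1.
split.
  by apply: (@measurable_semigroup _ _ _ _ _ _ hN _ 1) => //;
    exact: measurable_indic.
exists (expR (`|t| * Lambda)) => eta _.
have S : series (fun k => t ^+ k / k`!%:R * iter k generator \1_B eta) @ \oo -->
    semigroup t \1_B eta by exact: semigroup_cvg.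
rewrite -(cvg_lim (@Rhausdorff R) (cvg_norm S)).
apply: limr_le; first by apply/cvg_ex; eexists; apply: cvg_norm; exact: S.
near=> m; apply: le_trans (ler_norm_sum _ _ _) _.
apply: (@le_trans _ _ (series (exp_coeff (`|t| * Lambda)) m)).
  by apply: ler_sum => k _; rewrite -[leRHS]mul1r; exact: semigroup_term_le.
apply: nondecreasing_cvgn_le; last exact: is_cvg_series_exp_coeff.
apply/nondecreasing_seqP => k; rewrite seriesSr lerDl.
by rewrite exp_coeff_ge0// mulr_ge0// rate_bound_ge0.
Unshelve. all: by end_near. Qed.

Lemma meanD f g t : 0 <= t -> observable f -> observable g ->
  mean (fun eta => f eta + g eta) t = mean f t + mean g t.
Proof. by move=> t0 of_ og; apply: RintegralD => //; exact: observable_integrable. Qed.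

Lemma meanB f g t : 0 <= t -> observable f -> observable g ->
  mean (fun eta => f eta - g eta) t = mean f t - mean g t.
Proof. by move=> t0 of_ og; apply: RintegralB => //; exact: observable_integrable. Qed.

Lemma meanZ c f t : 0 <= t -> observable f ->
  mean (fun eta => c * f eta) t = c * mean f t.
Proof. by move=> t0 of_; apply: RintegralZl => //; exact: observable_integrable. Qed.

Lemma mean_cst c t : mean (fun=> c) t = c.
Proof. exact: Rintegral_prob_cst. Qed.

Lemma mean_sum (I : Type) (s : seq I) (F : I -> config -> R) t :
  0 <= t -> (forall i, observable (F i)) ->
  mean (fun eta => \sum_(i <- s) F i eta) t = \sum_(i <- s) mean (F i) t.
Proof.
move=> t0 oF; elim: s => [|i s ih].
  rewrite big_nil -[RHS](mean_cst 0 t); congr mean; apply/funext => eta.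
  by rewrite big_nil.
rewrite big_cons -ih -meanD//; last exact: observable_sum.
by congr mean; apply/funext => eta; rewrite big_cons.
Qed.

Lemma mean_le f g t : 0 <= t -> observable f -> observable g ->
  (forall eta, state_space eta -> f eta <= g eta) -> mean f t <= mean g t.
Proof.
move=> t0 of_ og fg; apply: le_Rintegral => //; try exact: observable_integrable.
by move=> w _; apply/fg/state_space_xi.
Qed.

Lemma mean_norm_le f M t : 0 <= t -> observable f -> bounded_by f M ->
  `|mean f t| <= M.
Proof.
move=> t0 of_ fM; rewrite ler_norml; apply/andP; split.
  rewrite -[leLHS](mean_cst _ t); apply: mean_le => //.
    exact: observable_cst.
  by move=> eta /fM; rewrite ler_norml => /andP[].
rewrite -[leRHS](mean_cst _ t); apply: mean_le => //.
  exact: observable_cst.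
by move=> eta /fM; rewrite ler_norml => /andP[].
Qed.

Lemma mean_indic B t : 0 <= t -> measurable B ->
  mean \1_B t = fine (P (xi t @^-1` B)).
Proof.
move=> t0 mB; rewrite -Rintegral_indic.
  by rewrite /mean; congr Rintegral; apply/funext => w; rewrite !indicE.
by have := HK_measurable hxi t0 measurableT mB; rewrite setTI.
Qed.

(** * Markov property and first order expansion of the means *)

Lemma natural_filtration_now t B : 0 <= t -> measurable B ->
  natural_filtration xi t (xi t @^-1` B).
Proof.
move=> t0 mB; apply: sub_sigma_algebra; exists t.
  by rewrite /= in_itv /= t0 lexx.
by exists B => //; rewrite setTI.
Qed.

Lemma mean_markov t h B : 0 <= t -> 0 <= h -> measurable B ->
  mean \1_B (t + h) = mean (semigroup h \1_B) t.
Proof.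
move=> t0 h0 mB; rewrite mean_indic ?addr_ge0// /mean /Rintegral; congr fine.
have := HK_markov hxi t0 h0 (natural_filtration_now t0 (@measurableT _ mconfig)) mB.
by rewrite preimage_setT setTI.
Qed.

Lemma observable_ge0 f M :
  measurable_fun [set: mconfig] (f : mconfig -> R) ->
  (forall eta, state_space eta -> 0 <= f eta <= M) -> observable f.
Proof.
by move=> mf fM; split=> //; exists M => eta /fM/andP[f0 fM']; rewrite ger0_norm.
Qed.

(** The Markov property speaks of indicators: it replaces the time shift by [semigroup h], whose
    first order expansion is then integrated. *)
Lemma mean_indic_step t h B : 0 <= t -> 0 <= h <= 1 -> measurable B ->
  `|mean \1_B (t + h) - mean \1_B t - h * mean (generator \1_B) t| <=
  h ^+ 2 * expR Lambda.
Proof.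
move=> t0 h01 mB; have /andP[h0 h1] := h01.
have oB := observable_indic mB; have oG := observable_generator oB.
have oS := observable_semigroup_indic h mB.
rewrite mean_markov// -meanZ// -!meanB//; last 2 first.
- exact: observableB.
- exact: observableZ.
apply: mean_norm_le => //.
  by apply: observableB; [exact: observableB|exact: observableZ].
move=> eta _; rewrite -[expR Lambda]mulr1.
apply: semigroup_first_order => // eta'.
by rewrite indicE normr_nat lern1 leq_b1.
Qed.

Lemma quantize_bounds (m : nat) (y : R) : 0 <= y -> y <= m%:R ->
  `|y - \sum_(i < m) (i.+1%:R <= y)%R%:R| <= 1.
Proof.
move=> y0 ym; set S := fun m => \sum_(i < m) (i.+1%:R <= y)%R%:R : R.
(* The sum is the integer part of [y] truncated at [m]: either all thresholds are passed, or the sum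
   is within 1 of [y]. *)
have [Sy [_ Sm]] : S m <= y /\ S m <= m%:R /\ (S m = m%:R \/ y - 1 <= S m).
  elim: m {ym} => [|m [Sy [Sm ih]]].
    by rewrite /S big_ord0; split => //; split => //; left.
  rewrite /S big_ord_recr /= -/(S m).
  have [my|my] := leP m.+1%:R y.
    have SmE : S m = m%:R.
      case: ih => // ih; move: my; rewrite -natr1 => my.
      by apply/eqP; rewrite eq_le Sm; lra.
    by rewrite SmE natr1; split => //; split => //; left.
  rewrite addr0 -natr1; split => //; split; first by rewrite ler_wpDr.
  right; case: ih => // ->; move: my; rewrite -natr1; lra.
rewrite -/(S m) ler_norml; apply/andP; split; first lra.
by case: Sm => Sm; lra.
Qed.

(* [f] is approximated by the staircase [\sum_i (M / m) * \1_(i M / m <= f)],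
   whose coefficients add up to [M]: the second-order errors of the indicators
   then add up to [M] times a single one, whatever the number of steps. *)
Lemma mean_step f M t h : 0 <= t -> 0 <= h <= 1 ->
  measurable_fun [set: mconfig] (f : mconfig -> R) ->
  (forall eta, state_space eta -> 0 <= f eta <= M) ->
  `|mean f (t + h) - mean f t - h * mean (generator f) t| <=
  h ^+ 2 * (expR Lambda * M).
Proof.
move=> t0 h01 mf fM; have /andP[h0 h1] := h01.
have th0 : 0 <= t + h by exact: addr_ge0.
have M0 : 0 <= M.
  have Dxi : state_space (xi t point) by exact: state_space_xi.
  by have /andP[] := fM _ Dxi; exact: le_trans.
have of_ := observable_ge0 mf fM.
apply/ler_addgt0Pr => e e0.
(* Replacing [f] by the staircase costs one step height [dl] at each of the two times and at most
   [Lambda * dl] in the generator term. *)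
have [m me] := exists_natmul_gt (M * (2 + Lambda)) e0.
pose dl := M / m.+1%:R; have m0 : (0 : R) < m.+1%:R by [].
have dl0 : 0 <= dl by rewrite divr_ge0// ltW.
pose B i : set mconfig := [set eta | i.+1%:R <= m.+1%:R / M * f eta].
have mB i : measurable (B i).
  by apply: measurable_ler_set => //; exact: measurable_funM.
pose fm eta := \sum_(i < m.+1) dl * \1_(B i) eta.
have ofm : observable fm.
  apply: observable_sum => i.
  by apply: observableZ; exact: observable_indic.
have od := observableB of_ ofm.
have f_fm : bounded_by (fun eta => f eta - fm eta) dl.
  move=> eta De; have /andP[f0 fM'] := fM _ De.
  (* For [M = 0] the quotient by [M] is a default value, but [f] and the step height both vanish. *)
  have [M00|M00] := eqVneq M 0.
    have -> : f eta = 0 by apply/eqP; rewrite eq_le f0 andbT -M00.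
    rewrite /fm /dl M00 mul0r; under eq_bigr do rewrite mul0r.
    by rewrite sumr_const mul0rn subrr normr0.
  have {}M00 : 0 < M by rewrite lt_neqAle eq_sym M00.
  have := @quantize_bounds m.+1 (m.+1%:R / M * f eta).
  rewrite mulr_ge0 ?divr_ge0// => /(_ isT).
  rewrite mulrAC ler_pdivrMr// ler_pM2l// => /(_ fM') qb.
  rewrite /fm -mulr_sumr.
  have -> : f eta - dl * \sum_(i < m.+1) \1_(B i) eta =
      dl * (m.+1%:R * f eta / M -
        \sum_(i < m.+1) (i.+1%:R <= m.+1%:R * f eta / M)%R%:R).
    rewrite mulrBr; congr (_ - _).
      by rewrite /dl; field; rewrite nat1r pnatr_eq0 gt_eqF.
    congr (_ * _); apply: eq_bigr => i _; rewrite indicE; congr (_%:R).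
    congr nat_of_bool; rewrite mulrAC.
    by apply/idP/idP; rewrite inE.
  by rewrite normrM ger0_norm// ler_piMr.
have step_fm : `|mean fm (t + h) - mean fm t - h * mean (generator fm) t| <=
    h ^+ 2 * (expR Lambda * M).
  have mfm s : 0 <= s -> mean fm s = \sum_(i < m.+1) dl * mean \1_(B i) s.
    move=> s0; rewrite mean_sum//; last first.
      by move=> i; apply: observableZ; exact: observable_indic.
    by apply: eq_bigr => i _; rewrite meanZ//; exact: observable_indic.
  have -> : mean (generator fm) t =
      \sum_(i < m.+1) dl * mean (generator \1_(B i)) t.
    have -> : generator fm =
        fun eta => \sum_(i < m.+1) dl * generator \1_(B i) eta.
      apply/funext => eta; rewrite generator_sum; apply: eq_bigr => i _.
      by rewrite generatorZ.
    have oG i : observable (generator \1_(B i)).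
      by apply: observable_generator; exact: observable_indic.
    rewrite mean_sum//; last by move=> i; exact: observableZ.
    by apply: eq_bigr => i _; rewrite meanZ.
  rewrite !mfm// mulr_sumr -!sumrB.
  apply: le_trans (ler_norm_sum _ _ _) _.
  have -> : h ^+ 2 * (expR Lambda * M) =
      \sum_(i < m.+1) dl * (h ^+ 2 * expR Lambda).
    rewrite sumr_const card_ord -mulr_natl /dl; field.
    by rewrite nat1r pnatr_eq0.
  apply: ler_sum => i _.
  rewrite [h * (dl * _)]mulrCA -!mulrBr normrM ger0_norm// ler_wpM2l//.
  exact: mean_indic_step.
have mf_fm s : 0 <= s -> `|mean f s - mean fm s| <= dl.
  by move=> s0; rewrite -meanB//; exact: mean_norm_le.
have mG : `|mean (generator f) t - mean (generator fm) t| <= Lambda * dl.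
  rewrite -meanB//; try exact: observable_generator.
  apply: mean_norm_le => //.
    by apply: observableB; exact: observable_generator.
  move=> eta De; rewrite -generatorB; apply: generator_le_at.
    exact: f_fm.
  by move=> x c0; apply/f_fm/state_space_update.
have hG : `|h * (mean (generator f) t - mean (generator fm) t)| <= Lambda * dl.
  by rewrite normrM ger0_norm//; apply: le_trans mG; rewrite ler_piMl.
have dle : dl * (2 + Lambda) <= e.
  by rewrite /dl mulrAC ler_pdivrMr// ltW.
move: (mf_fm _ t0) (mf_fm _ th0) hG step_fm.
rewrite !ler_norml => /andP[a1 a2] /andP[b1 b2] /andP[c1 c2] /andP[g1 g2].
apply/andP; split; lra.
Qed.

(** Cutting the time interval into equal steps, the second order errors add up to [t ^+ 2 * K] over
    the number of steps, which is arbitrarily small. *)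
Lemma mean_supermartingale f M t : 0 <= t ->
  measurable_fun [set: mconfig] (f : mconfig -> R) ->
  (forall eta, state_space eta -> 0 <= f eta <= M) ->
  (forall eta, state_space eta -> generator f eta <= 0) ->
  mean f t <= mean f 0.
Proof.
move=> t0 mf fM Gf; set K := expR Lambda * M.
have of_ := observable_ge0 mf fM.
have step s h : 0 <= s -> 0 <= h <= 1 -> mean f (s + h) <= mean f s + h ^+ 2 * K.
  move=> s0 h01; have /andP[h0 h1] := h01.
  have := mean_step s0 h01 mf fM; rewrite ler_norml => /andP[_ ].
  have : mean (generator f) s <= 0.
    rewrite -(mean_cst 0 s); apply: mean_le => //.
      exact: observable_generator.
    exact: observable_cst.
  by move=> /(mulr_ge0_le0 h0); rewrite -/K; lra.
apply/ler_addgt0Pr => e e0.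
(* The first term makes the total error at most [e], the second makes the step length at most 1. *)
have [m me] := exists_natmul_gt (`|t ^+ 2 * K| + e * t) e0.
have m0 : (0 : R) < m.+1%:R by [].
have tm : t <= m.+1%:R.
  rewrite -(ler_pM2l e0); apply: ltW; apply: le_lt_trans me.
  by rewrite lerDr.
have h01 : 0 <= t / m.+1%:R <= 1 by rewrite divr_ge0//= ler_pdivrMr// mul1r.
have iter_step i : mean f (i%:R * (t / m.+1%:R)) <=
    mean f 0 + i%:R * ((t / m.+1%:R) ^+ 2 * K).
  elim: i => [|i ih]; first by rewrite !mul0r addr0.
  rewrite -natr1 mulrDl mul1r mulrDl mul1r.
  apply: le_trans (step _ _ _ h01) _.
    by rewrite mulr_ge0 //; case/andP: h01.
  by rewrite addrA lerD2r.
have := iter_step m.+1.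
rewrite mulrCA divff ?mulr1 ?gt_eqF// => /le_trans; apply.
rewrite lerD2l.
have -> : m.+1%:R * ((t / m.+1%:R) ^+ 2 * K) = t ^+ 2 * K / m.+1%:R.
  by field; rewrite nat1r pnatr_eq0.
rewrite ler_pdivrMr//; apply: le_trans (ler_norm _) _; apply: le_trans (ltW me).
by rewrite lerDl mulr_ge0// ltW.
Qed.

(** Otherwise the mean of [f] would increase by a fixed amount over each step of length [h] and
    would eventually exceed [M]. *)
Lemma mean_generator_small f M e :
  measurable_fun [set: mconfig] (f : mconfig -> R) ->
  (forall eta, state_space eta -> 0 <= f eta <= M) -> 0 < e ->
  exists2 t, 0 <= t & mean (generator f) t <= e.
Proof.
move=> mf fM e0; apply: contrapT => noT.
have of_ := observable_ge0 mf fM.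
have Ge t : 0 <= t -> e <= mean (generator f) t.
  by move=> t0; rewrite leNgt; apply/negP => /ltW Gt; apply: noT; exists t.
have M0 : 0 <= M.
  have Dxi : state_space (xi 0 point) by exact: state_space_xi.
  by have /andP[] := fM _ Dxi; exact: le_trans.
set K := expR Lambda * M.
have K0 : 0 <= K by rewrite mulr_ge0// expR_ge0.
(* Chosen so that [h <= 1] and the error [h ^+ 2 * K] consumes at most half of the gain [h * e]. *)
pose h := e / (2 * (K + 1) + e).
have den0 : 0 < 2 * (K + 1) + e by lra.
have h0 : 0 < h by rewrite divr_gt0.
have h1 : h <= 1 by rewrite /h ler_pdivrMr// mul1r; lra.
have h01 : 0 <= h <= 1 by rewrite ltW.
have hK : h * K <= e / 2.
  rewrite /h mulrAC ler_pdivrMr// -subr_ge0.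
  have -> : e / 2 * (2 * (K + 1) + e) - e * K = e + e ^+ 2 / 2 by field.
  by rewrite addr_ge0 ?divr_ge0 ?sqr_ge0// ltW.
have step s : 0 <= s -> mean f s + h * (e / 2) <= mean f (s + h).
  move=> s0; have := mean_step s0 h01 mf fM; rewrite ler_norml => /andP[+ _].
  rewrite -/K; have := Ge _ s0; rewrite -(ler_pM2l h0) => he.
  have : h ^+ 2 * K <= h * (e / 2) by rewrite expr2 -mulrA ler_pM2l.
  by lra.
have iter_step i : i%:R * (h * (e / 2)) <= mean f (i%:R * h).
  elim: i => [|i ih].
    rewrite !mul0r -[leLHS](mean_cst _ 0); apply: mean_le => //.
      exact: observable_cst.
    by move=> eta /fM/andP[].
  rewrite -natr1 mulrDl mul1r [in leRHS]mulrDl mul1r.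
  have ih0 : 0 <= i%:R * h by rewrite mulr_ge0// ltW.
  by apply: le_trans (step _ ih0); rewrite lerD2r.
have he0 : 0 < h * (e / 2) by rewrite mulr_gt0// divr_gt0.
have [m Mm] := exists_natmul_gt M he0.
have := iter_step m.+1; rewrite leNgt => /negP; apply.
apply: le_lt_trans (_ : M < _); last by rewrite mulrC.
apply: le_trans (ler_norm _) _; apply: mean_norm_le => //.
  by rewrite mulr_ge0// ltW.
by move=> eta /fM/andP[f0 fM']; rewrite ger0_norm.
Qed.

(** * Probability of a large discord at a given time *)

Context (c : 'rV[R]_n) (r : R).
Hypothesis hG : simple_connected_graph E.
Hypothesis Delta_bounded : exists M : R, forall a, Delta a -> N a <= M.
Hypothesis c_center : forall a, Delta a -> N (a - c) <= r.
Hypothesis r_lt_tau : r < tau.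

Definition discordant e t := [set w | e < discord N (xi t w)].

Lemma measurable_discord_gt e :
  measurable ([set eta | e < discord N eta] : set mconfig).
Proof. by apply: measurable_ltr_set => //; exact: measurable_discord. Qed.

Lemma measurable_discord_le e :
  measurable ([set eta | discord N eta <= e] : set mconfig).
Proof. by apply: measurable_ler_set => //; exact: measurable_discord. Qed.

Lemma measurable_discordant e t : 0 <= t -> measurable (discordant e t).
Proof.
move=> t0; have := HK_measurable hxi t0 measurableT (measurable_discord_gt e).
by rewrite setTI.
Qed.

(* [discord <= e] is stable under updates, so the exponential series of the
   indicator of its complement vanishes there term by term. *)
Lemma discordant_later_null e s t : 0 <= s <= t ->
  P (~` discordant e s `&` discordant e t) = 0%E.
Proof.
move=> /andP[s0 st]; have ts0 : 0 <= t - s by rewrite subr_ge0.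
have := HK_markov hxi s0 ts0 (natural_filtration_now s0 (measurable_discord_le e))
  (measurable_discord_gt e).
rewrite addrC subrK => PE.
have -> : ~` discordant e s = xi s @^-1` [set eta | discord N eta <= e].
  by apply/seteqP; split=> w /=; rewrite /discordant /= leNgt => /negP.
rewrite PE; apply: integral0_eq => w /= we; congr EFin.
apply: (semigroup_closed_eq0 (A := [set eta | discord N eta <= e])) => //=.
  move=> eta x etae c0; apply: le_trans etae; exact: discord_update.
by move=> eta etae; rewrite indicE memNset //=; apply/negP; rewrite -leNgt.
Qed.

Lemma measurable_sum_norm_center :
  measurable_fun [set: mconfig] (fun eta => \sum_x N (eta x - c)).
Proof. by apply: measurable_sum => x; exact: measurable_norm_center. Qed.

Lemma sum_norm_center_bounds eta : state_space eta ->
  0 <= \sum_x N (eta x - c) <= #|V|%:R * r.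
Proof.
move=> De; rewrite sumr_ge0 => [|x _]; last exact: norm_ge0.
by rewrite mulr_natl -sumr_const ler_sum// => x _; exact/c_center/De.
Qed.

Lemma mean_norm_center_le t : 0 <= t ->
  mean (fun eta => \sum_x N (eta x - c)) t <= mean (fun eta => \sum_x N (eta x - c)) 0.
Proof.
move=> t0; apply: mean_supermartingale t0 measurable_sum_norm_center
  sum_norm_center_bounds _.
by move=> eta _; exact: generator_norm_center_le0.
Qed.

Lemma coordinates_bounded :
  exists2 M : R, 0 <= M & forall a j, Delta a -> `|a 0 j| <= M.
Proof.
have [M DM] := Delta_bounded; have [k k0 kN] := coord_le_norm hN.
exists (k * `|M|) => [|a j Da]; first by rewrite mulr_ge0.
apply: le_trans (kN _ _) _; rewrite ler_wpM2l//.
by apply: le_trans (DM _ Da) _; exact: ler_norm.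
Qed.

Lemma measurable_total_sqr : measurable_fun [set: mconfig]
  (fun eta => \sum_j (\sum_x eta x 0 j) ^+ 2).
Proof.
apply: measurable_sum => j; apply: measurable_funX; apply: measurable_sum => x.
exact: measurable_opinion_coord.
Qed.

Lemma total_sqr_bounds : exists M, forall eta, state_space eta ->
  0 <= \sum_j (\sum_x eta x 0 j) ^+ 2 <= M.
Proof.
have [M M0 DM] := coordinates_bounded.
exists (\sum_(j < n) (#|V|%:R * M) ^+ 2) => eta De.
rewrite sumr_ge0 => [|j _]; last exact: sqr_ge0.
apply: ler_sum => j _; rewrite -real_normK ?num_real//.
rewrite ler_pXn2r ?nnegrE ?mulr_ge0//.
apply: le_trans (ler_norm_sum _ _ _) _; rewrite mulr_natl -sumr_const.
by apply: ler_sum => x _; exact/DM/De.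
Qed.

Lemma dissipationE : dissipation N tau E =
  generator (fun eta => \sum_j (\sum_x eta x 0 j) ^+ 2).
Proof. by apply/funext => eta; rewrite generator_total_sqr. Qed.

Lemma mean_dissipation_small e : 0 < e ->
  exists2 t, 0 <= t & mean (dissipation N tau E) t <= e.
Proof.
move=> e0; have [M fM] := total_sqr_bounds; rewrite dissipationE.
exact: (mean_generator_small measurable_total_sqr fM e0).
Qed.

(** Expectation of [far_indicator_le] at a time of small mean dissipation, the distance to [c] being
    bounded by its initial mean. One [e] is the pointwise error, the other pays for the
    dissipation. *)
Lemma discordant_prob_le a e : 0 < e ->
  mean (fun eta => \sum_x N (eta x - c)) 0 <= #|V|%:R * a -> 0 <= a ->
  exists2 t, 0 <= t & (tau - r) * fine (P (discordant e t)) <= a + 2 * e.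
Proof.
move=> e0 mean0 a0; have [M M0 DM] := coordinates_bounded.
have [K K0 farK] := far_indicator_le hN hG c_center r_lt_tau DM e0.
(* [K] is fixed before the time is chosen, so the mean dissipation can be made small relative to
   it. *)
have eK0 : 0 < e / (K + 1) by rewrite divr_gt0// ltr_pwDr.
have [t t0 Dt] := mean_dissipation_small eK0; exists t => //.
have oI := observable_indic (measurable_discord_gt e).
have oS := observable_ge0 measurable_sum_norm_center sum_norm_center_bounds.
have oD : observable (dissipation N tau E).
  have [? fM] := total_sqr_bounds; rewrite dissipationE.
  apply: observable_generator; exact: observable_ge0 measurable_total_sqr fM.
have PE : fine (P (discordant e t)) = mean \1_[set eta | e < discord N eta] t.
  by rewrite mean_indic//; exact: measurable_discord_gt.
rewrite PE -meanZ//.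
have : mean (fun eta => (tau - r) * \1_[set eta | e < discord N eta] eta) t <=
    mean (fun eta => #|V|%:R^-1 * (\sum_x N (eta x - c)) + e
      + K * dissipation N tau E eta) t.
  have oe := observable_cst e.
  have oA := observableD (observableZ #|V|%:R^-1 oS) oe.
  apply: mean_le => //; first exact: observableZ.
    by apply: observableD => //; exact: observableZ.
  move=> eta De; rewrite mulrC indicE; apply: le_trans (farK _ De).
  by rewrite le_eqVlt; apply/orP; left; apply/eqP; congr (_%:R * _);
    congr nat_of_bool; apply/idP/idP; rewrite inE.
rewrite meanD//; last 2 first.
- by apply: observableD; [exact: observableZ|exact: observable_cst].
- exact: observableZ.
rewrite meanD//; last 2 first.
- exact: observableZ.
- exact: observable_cst.
rewrite !meanZ// mean_cst => /le_trans; apply.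
have mA : #|V|%:R^-1 * mean (fun eta => \sum_x N (eta x - c)) t <= a.
  have [V0|V0] := eqVneq #|V| 0%N; first by rewrite V0 invr0 mul0r.
  rewrite mulrC ler_pdivrMr ?ltr0n ?lt0n// mulrC.
  by apply: le_trans mean0; exact: mean_norm_center_le.
have KD : K * mean (dissipation N tau E) t <= e.
  apply: (@le_trans _ _ (K * (e / (K + 1)))); first by rewrite ler_wpM2l.
  rewrite mulrCA -[leRHS]mulr1 ler_pM2l// ler_pdivrMr ?mul1r ?ltr_pwDr//.
  by rewrite lerDl.
by rewrite mulrDl mul1r addrA lerD// lerD.
Qed.

(** * The consensus event through rational times *)

Definition rat_time (i : nat) : R := ratr (odflt 0 (unpickle i)).

Lemma rat_time_dense t u : t < u -> exists i, t < rat_time i < u.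
Proof.
move=> /rat_in_itvoo[q]; rewrite in_itv /= => qtu.
by exists (pickle q); rewrite /rat_time pickleK.
Qed.

(** A countable union, hence measurable; the lower bound [m%:R] also discards the negative rationals
    enumerated by [rat_time]. *)
Definition discordant_after (k m : nat) : set T :=
  \bigcup_i [set w | m%:R <= rat_time i /\ discordant k.+1%:R^-1 (rat_time i) w].

Lemma measurable_discordant_after k m : measurable (discordant_after k m).
Proof.
apply: bigcupT_measurable => i.
have [mi|mi] := pselect (m%:R <= rat_time i); last first.
  rewrite [X in measurable X](_ : _ = set0)//.
  by apply/seteqP; split => // w [].
rewrite [X in measurable X](_ : _ = discordant k.+1%:R^-1 (rat_time i)).
  by apply: measurable_discordant; exact: le_trans mi.
by apply/seteqP; split => [w []|].
Qed.

(* Right continuity of the paths reduces the limit to rational times. *)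
Lemma consensusE :
  consensus N xi = ~` \bigcup_k \bigcap_m discordant_after k m.
Proof.
apply/seteqP; split=> w; rewrite /consensus /=.
  move=> /cvgrPdist_lt dcvg [k _ kw].
  have k0 : 0 < k.+1%:R^-1 :> R by rewrite invr_gt0.
  have [A [_ AP]] := dcvg _ k0.
  have [i _ [mi]] := kw (Num.bound `|A|) I; rewrite /discordant /= => ki.
  have Ai : A < rat_time i.
    apply: le_lt_trans (ler_norm _) _; apply: lt_le_trans mi.
    exact: archi_boundP.
  have := AP _ Ai; rewrite /= sub0r normrN ltNge => /negP; apply.
  exact: le_trans (ltW ki) (ler_norm _).
move=> settled; apply/cvgrPdist_le => e e0.
have [k _ kP] := near_infty_natSinv_lt (PosNum e0).
have {}kP : k.+1%:R^-1 < e by apply: (kP k) => /=.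
have /existsNP[m /not_implyP[_ mw]] : ~ (\bigcap_m discordant_after k m) w.
  by move=> kw; apply: settled; exists k.
exists m%:R; split; first exact: num_real.
move=> t mt; have t0 : 0 <= t by apply: le_trans (ltW mt).
rewrite /= sub0r normrN ger0_norm; last exact: bigmax_ge_id.
apply: le_trans (ltW kP); rewrite leNgt; apply/negP => kt; apply: mw.
have [[dl /= dl0 dlP] _] := HK_paths hxi w t0.
have [i /andP[ti itdl]] : exists i, t < rat_time i < t + dl.
  by apply: rat_time_dense; rewrite ltrDl.
exists i => //; split; first by apply: ltW; exact: lt_trans ti.
rewrite /discordant /= dlP//=.
by rewrite distrC ger0_norm ?subr_ge0 ?ltW// ltrBlDl.
Qed.

Lemma measurable_consensus : measurable (consensus N xi).
Proof.
rewrite consensusE; apply: measurableC; apply: bigcupT_measurable => k.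
by apply: bigcapT_measurable => m; exact: measurable_discordant_after.
Qed.

(** Becoming discordant at a rational time after [t] without being so at [t] is a countable union of
    null events [Zi i]; outside it, recurrent discord forces discord at [t]. *)
Lemma discordant_forever_prob_le k t : 0 <= t ->
  (P (\bigcap_m discordant_after k m) <= P (discordant (k.+1%:R^-1)%R t))%E.
Proof.
move=> t0; set e := k.+1%:R^-1; set m := Num.bound t.
pose Zi i := [set w | t <= rat_time i /\
  (~` discordant e t `&` discordant e (rat_time i)) w].
have Zi0 i : measurable (Zi i) /\ P (Zi i) = 0%E.
  have [ti|ti] := pselect (t <= rat_time i); last first.
    rewrite (_ : Zi i = set0); first by rewrite measure0.
    by apply/seteqP; split => // w [].
  rewrite (_ : Zi i = ~` discordant e t `&` discordant e (rat_time i)); last first.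
    by apply/seteqP; split => [w []|].
  split; last by apply: discordant_later_null; rewrite t0.
  apply: measurableI; first by apply: measurableC; exact: measurable_discordant.
  by apply: measurable_discordant; exact: le_trans ti.
have mZ : measurable (\bigcup_i Zi i).
  by apply: bigcupT_measurable => i; exact: (Zi0 i).1.
have Z0 : P (\bigcup_i Zi i) = 0%E.
  apply: measure_negligible => //; apply: negligible_bigcup => i.
  by apply/negligibleP; [exact: (Zi0 i).1|exact: (Zi0 i).2].
rewrite -(measureU0 (measurable_discordant e t0) mZ Z0).
apply: le_measure; rewrite ?inE.
- by apply: bigcapT_measurable => m'; exact: measurable_discordant_after.
- by apply: measurableU => //; exact: measurable_discordant.
move=> w /(_ m I)[i _ [mi wi]].
have [wt|wt] := pselect (discordant e t w); first by left.
right; exists i => //; split => //.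
by apply: le_trans mi; apply: ltW; exact: archi_boundP.
Qed.

(** The events [G k] increase to the complement of consensus, so by continuity from below a bound
    uniform in [k] suffices. *)
Lemma consensusC_prob_le a :
  mean (fun eta => \sum_x N (eta x - c)) 0 <= #|V|%:R * a -> 0 <= a ->
  (P (~` consensus N xi) <= (a / (tau - r))%:E)%E.
Proof.
move=> mean0 a0; have tr0 : 0 < tau - r by rewrite subr_gt0.
pose G k := \bigcap_m discordant_after k m.
have mG k : measurable (G k).
  by apply: bigcapT_measurable => m; exact: measurable_discordant_after.
have Gle k : (P (G k) <= (a / (tau - r))%:E)%E.
  have k0 : 0 < k.+1%:R^-1 :> R by rewrite invr_gt0.
  rewrite -(@fineK _ (P (G k))) ?fin_num_measure// lee_fin ler_pdivlMr//.
  (* Being below [k.+1%:R^-1] makes discord at level [e] the larger event; being below [e' / 2]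
     absorbs the error [2 * e]. *)
  apply/ler_addgt0Pr => e' e'0; pose e := Num.min k.+1%:R^-1 (e' / 2).
  have e0 : 0 < e by rewrite lt_min k0 divr_gt0.
  have [t t0 te] := discordant_prob_le e0 mean0 a0.
  have ee' : 2 * e <= e'.
    by rewrite mulrC -ler_pdivlMr// ge_min lexx orbT.
  rewrite mulrC; apply: (@le_trans _ _ (a + 2 * e)); last by rewrite lerD2l.
  apply: le_trans te; rewrite ler_pM2l// fine_le ?fin_num_measure//.
    exact: measurable_discordant.
  apply: le_trans (discordant_forever_prob_le k t0) _.
  apply: le_measure; rewrite ?inE; try exact: measurable_discordant.
  by move=> w; apply: le_lt_trans; rewrite ge_min lexx.
have GU : measurable (\bigcup_k G k) by exact: bigcupT_measurable.
rewrite consensusE setCK.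
have nd : nondecreasing_seq G.
  apply/nondecreasing_seqP => k; rewrite subsetEset => w kw m _.
  have [i _ [mi wi]] := kw m I; exists i => //; split => //.
  apply: le_lt_trans wi; rewrite lef_pV2 ?posrE// ler_nat.
  by [].
have cvgG := @nondecreasing_cvg_mu _ _ _ P _ mG GU nd.
rewrite -(cvg_lim _ cvgG)//.
apply: lime_le; first by apply/cvg_ex; eexists; exact: cvgG.
by apply: nearW => k; exact: Gle.
Qed.
End HK_expectation.

(** * The initial law and the consensus probability *)

Lemma initial_norm_expectation (R : realType) (n : nat) (N : 'rV[R]_n -> R)
    (V : finType) (d : measure_display) (T : measurableType d)
    (P : probability T R) (Y : T -> V -> 'rV[R]_n)
    (d' : measure_display) (T' : measurableType d') (P' : probability T' R)
    (X : T' -> 'rV[R]_n) (c : 'rV[R]_n) x :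
  is_norm N ->
  measurable_fun [set: T] (Y : T -> mconfig V R n) ->
  measurable_fun [set: T'] (X : T' -> borel_rV R n) ->
  iid_as P Y P' X ->
  (\int[P]_w (N (Y w x - c))%:E = \int[P']_w (N (X w - c))%:E)%E.
Proof.
move=> hN mY mX [_ law].
have mYx : measurable_fun [set: T] (fun w => Y w x : borel_rV R n).
  exact: (measurableT_comp (measurable_opinion x) mY).
have mN : measurable_fun [set: borel_rV R n] (fun u : borel_rV R n =>
    (N ((u : 'rV[R]_n) - c))%:E).
  by apply/measurable_EFinP; exact: measurable_is_norm_sub.
have N0 : {in [set: borel_rV R n], forall u, (0 <= (N ((u : 'rV[R]_n) - c))%:E)%E}.
  by move=> u _; rewrite lee_fin norm_ge0.
have := ge0_integral_pushforward mYx P measurableT mN N0.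
have := ge0_integral_pushforward mX P' measurableT mN N0.
rewrite !preimage_setT /= => <- <-.
by apply: eq_measure_integral => B mB _; exact: law.
Qed.

Theorem theorem1 (R : realType) (n : nat)
  (N : 'rV[R]_n -> R) (hN : is_norm N)
  (Delta : set 'rV[R]_n)
  (Delta_bounded : exists M : R, forall a, Delta a -> N a <= M)
  (Delta_convex : convex_set (Delta : set (convex_lmodType 'rV[R]_n)))
  (c : 'rV[R]_n) (hc : Delta c)
  (c_center : forall a, Delta a -> N (a - c) <= opinion_radius N Delta)
  (V : finType) (E : rel V) (hG : simple_connected_graph E)
  (tau : R) (tau_gt0 : 0 < tau)
  (d' : measure_display) (T' : measurableType d') (P' : probability T' R)
  (X : T' -> 'rV[R]_n)
  (X_measurable : measurable_fun [set: T'] (X : T' -> borel_rV R n))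
  (X_Delta : forall w, Delta (X w))
  (d : measure_display) (T : measurableType d) (P : probability T R)
  (xi : R -> T -> V -> 'rV[R]_n)
  (hxi : Hegselmann_Krause N Delta tau E P xi)
  (xi0_iid : iid_as P (xi 0) P' X)
  (tau_gt_radius : opinion_radius N Delta < tau) :
  (1 - 'E_P'[fun w => (N (X w - c))%R] * ((tau - opinion_radius N Delta)^-1)%:E
    <= P (consensus N xi))%E.
Proof.
set r := opinion_radius N Delta in c_center tau_gt_radius *.
rewrite unlock.
have N0 : (0 <= \int[P']_w (N (X w - c))%:E)%E.
  by apply: integral_ge0 => w _; rewrite lee_fin norm_ge0.
have mN : measurable_fun [set: T'] (fun w => N (X w - c)).
  exact: (measurableT_comp (measurable_is_norm_sub c hN) X_measurable).
(* This makes the expectation finite, so that it is a real number [a] and the conclusion becomes an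
   inequality between reals. *)
have Nr : (\int[P']_w (N (X w - c))%:E <= r%:E)%E.
  apply: (@le_trans _ _ (\int[P']_w (cst r%:E) w)%E).
    apply: ge0_le_integral => //.
    - by move=> w _; rewrite lee_fin norm_ge0.
    - exact/measurable_EFinP.
    - by move=> w _; rewrite lee_fin; exact: c_center.
  rewrite integral_cst// [X in (_ * X)%E](_ : _ = 1%E) ?mule1//.
  exact: probability_setT.
have [a Ea] : exists a : R, (\int[P']_w (N (X w - c))%:E = a%:E)%E.
  exists (fine (\int[P']_w (N (X w - c))%:E)); rewrite fineK//.
  by rewrite ge0_fin_numE//; exact: le_lt_trans Nr (ltry _).
rewrite Ea in N0 *; rewrite lee_fin in N0.
have mean0 : mean P xi (fun eta => \sum_x N (eta x - c)) 0 <= #|V|%:R * a.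
  rewrite (mean_sum hxi)//; last first.
    move=> x; apply: observable_ge0 (measurable_norm_center hN x c) _.
    by move=> eta De; rewrite norm_ge0//=; exact: c_center (De x).
  rewrite mulr_natl -sumr_const; apply: ler_sum => x _.
  have mxi0 := HK_measurable hxi (lexx 0).
  rewrite /mean /Rintegral.
  by rewrite (initial_norm_expectation c x hN mxi0 X_measurable xi0_iid) Ea.
have := consensusC_prob_le hN Delta_convex hxi hG Delta_bounded c_center
  tau_gt_radius mean0 N0.
have mC := measurable_consensus hN hxi.
rewrite probability_setC// -[P _]fineK ?fin_num_measure//.
rewrite -EFinM -!EFinB !lee_fin => PC; lra.
Qed.
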